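(* Let $L$ be the splitting field of $x^3-x^2-x-1$ over $\mathbb{Q}$. A prime number $p\neq 11$ splits completely in $L$ if and only if $p=x^2+11y^2$ for some $x,y\in\mathbb{Z}$.
   Context: A prime number $p$ splits completely in the number field $L$ if the ideal $p\mathcal{O}_L$ is a product of $[L:\mathbb{Q}]$ distinct prime ideals of the ring of integers $\mathcal{O}_L$. *)

(* Defs.v *)
From HB Require Import structures.
From mathcomp Require Import all_boot all_order all_algebra all_field.
From mathcomp Require Import boolp classical_sets.

Set Implicit Arguments.
Unset Strict Implicit.
Unset Printing Implicit Defensive.

Import GRing.Theory.
Local Open Scope ring_scope.

Definition is_algebraic_integer (L : fieldExtType rat) : {pred L} :=
  fun x => `[< integralOver (intr : int -> L) x >].

Fact is_algebraic_integer_subring (L : fieldExtType rat) :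
  subring_closed (@is_algebraic_integer L).
Proof.
split=> [|x y|x y].
- exact/asboolP/integral1.
- by move=> /asboolP ix /asboolP iy; apply/asboolP/integral_sub.
- by move=> /asboolP ix /asboolP iy; apply/asboolP/integral_mul.
Qed.

HB.instance Definition _ (L : fieldExtType rat) :=
  GRing.isSubringClosed.Build L (@is_algebraic_integer L)
    (@is_algebraic_integer_subring L).

Record ring_of_integers (L : fieldExtType rat) := RingOfIntegers {
  int_val :> L;
  int_valP : int_val \in @is_algebraic_integer L }.

HB.instance Definition _ (L : fieldExtType rat) := [isSub for @int_val L].
HB.instance Definition _ (L : fieldExtType rat) :=
  [Choice of ring_of_integers L by <:].
HB.instance Definition _ (L : fieldExtType rat) :=
  [SubChoice_isSubComNzRing of ring_of_integers L by <:].

Local Open Scope classical_set_scope.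

Definition principal_ideal (R : comNzRingType) (a : R) : set R :=
  [set a * b | b in setT].

(* The coefficients [r] matter only for the empty product, which is [R]. *)
Definition ideal_prod (R : comNzRingType) (n : nat) (I : 'I_n -> {pred R}) :
    set R :=
  [set x | exists (m : nat) (r : 'I_m -> R) (a : 'I_m -> 'I_n -> R),
     (forall k i, a k i \in I i) /\ x = \sum_k r k * \prod_i a k i].

(* [=i] rather than [=] in the injectivity condition: two bundled ideals count
   as equal as soon as they have the same elements. *)
Definition splits_completely (L : fieldExtType rat) (p : nat) : Prop :=
  exists P : 'I_(\dim {:L}) -> prime_idealr (ring_of_integers L),
    (forall i j, P i =i P j -> i = j) /\
    principal_ideal (p%:R : ring_of_integers L) = ideal_prod (fun i => P i).

(* Main.v *)
Require Import Defs.
From HB Require Import structures.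
From mathcomp Require Import all_boot all_order all_algebra all_fingroup all_field.
From mathcomp Require Import boolp classical_sets.
From mathcomp Require Import zify ring.

(** Let f = X^3 - X^2 - X - 1, whose discriminant is -44, and let O be the ring
    of integers of L.  The two sides of the equivalence are compared through
    the elementary condition [splits_mod p]: f is a product of linear factors
    modulo p.

    Ideals.  The Galois group G acts on O, and its invariants are the integers.
    A prime P of O over p has #|G| distinct conjugates when some c lies outside P
    while all its other conjugates lie in P ([isolating]).  The trace of c x is
    then an integer congruent to c x modulo P, so that O / P is the prime field:
    reducing the roots of f modulo P splits f modulo p.  If p splits completely,
    the factors of p form a single orbit of G, and counting shows that such a c
    exists ([ex_isolating]); moreover p is odd, because (1 + sqrt(-11)) / 2 lies
    in O and X^2 - X + 3 has no root modulo 2.  Conversely, let f split modulo p,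
    with p prime to 44.  Distinct roots of f stay distinct modulo a prime P over
    p, and each of them is congruent to an integer; hence only the identity
    stabilizes P, and c exists again.  The determinant of the conjugates of c
    shows that the conjugates of P intersect in p O, and an identity between
    powers of the conjugates of c that their product is p O
    ([isolating_splits]).

    Reciprocity.  By Cardano's formula, f splits modulo a prime p > 3 if and
    only if -11 is a square t^2 modulo p and the cubic residue symbol at p of
    19 + 3 sqrt(-3) t in the ring Z[w] of Eisenstein integers is trivial
    ([splits_mod_cardano], [cardano_splits_mod]).  Suppose that
    m = X^2 + 11 y^2 is odd and prime to 3, with X and y coprime, and take
    t = X / y modulo the primes dividing m.  Up to the
    rational factor y the element is 19 y + 3 sqrt(-3) X, of norm 27 m + 64 y^2.
    By cubic reciprocity ([cubic_reciprocity], proved with Gauss sums in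
    characteristic q) its symbols at the rational primes q are the values of one
    cubic character R modulo this norm.  Since 27 m = - 64 y^2 modulo the norm
    and 27, 64 and -1 are cubes, R(m) = R(y)^2; and R(y) = 1, because at a prime
    dividing y the element is a multiple of sqrt(-3) and has trivial symbol.  So
    the product of the symbols over the primes dividing m is trivial
    ([norm_form_character]).  This argument needs y prime to 3; otherwise
    X + y sqrt(-11) is first multiplied by 6 + sqrt(-11), of norm 47.

    For m = p this says that f splits modulo p.  Conversely, if f splits modulo p
    then -11 is a square modulo p, and since all forms of discriminant -11 are
    equivalent ([form_disc11_reduction]), p or 5 p is a value of x^2 + 11 y^2.
    The second case is impossible: the symbol at p is trivial, the one at 5 is
    not, and their product is trivial.  The primes 3 and 5, modulo which f has
    no root, and 47 are treated apart. *)

Set Implicit Arguments.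
Unset Strict Implicit.
Unset Printing Implicit Defensive.

Import Order.TTheory GRing.Theory Num.Theory.
Local Open Scope ring_scope.

(** * Gauss and Jacobi sums of cubic characters *)

Section CubicCharacter.
Variables (l : nat) (c : 'F_l).
Hypotheses (l_pr : prime l) (prim_c : 3.-primitive_root c).

(** The logarithm to base [c] of the cubic residue symbol of [t].  Keeping the
    exponent rather than the symbol gives one character with values in every
    field that contains a primitive cube root of unity. *)
Definition cubic_index (t : 'F_l) : nat :=
  if t ^+ (l.-1 %/ 3) == 1 then 0%N
  else if t ^+ (l.-1 %/ 3) == c then 1%N else 2%N.

Lemma Fp_expr_pred (t : 'F_l) : t != 0 -> t ^+ l.-1 = 1.
Proof.
move=> t0; apply: (mulfI t0); rewrite mulr1 -exprS prednK ?prime_gt0 //.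
by rewrite -{2}[t]expf_card card_Fp.
Qed.

Lemma dvdn3_pred : (3 %| l.-1)%N.
Proof.
rewrite (prim_order_dvd prim_c); apply/eqP; apply: Fp_expr_pred.
by apply/eqP=> c0; have := prim_expr_order prim_c; rewrite c0 expr0n => /eqP;
  rewrite eq_sym oner_eq0.
Qed.

Lemma cubic_indexP t : t != 0 -> t ^+ (l.-1 %/ 3) = c ^+ cubic_index t.
Proof.
move=> t0; rewrite /cubic_index; set x := t ^+ _.
have x3 : x ^+ 3 = 1 by rewrite -exprM divnK ?dvdn3_pred // Fp_expr_pred.
have [[i ltis] ->] := prim_rootP prim_c x3.
have e i' j' := eq_prim_root_expr prim_c i' j'.
have -> : (c ^+ i == 1) = (i == 0)%N by rewrite -(expr0 c) e !modn_small.
have -> : (c ^+ i == c) = (i == 1)%N by rewrite -{2}(expr1 c) e !modn_small.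
by move: ltis; case: i => [|[|[|]]].
Qed.

(** X^((l-1)/3) - 1 has too few roots. *)
Lemma ex_cubic_nonresidue : exists2 t : 'F_l, t != 0 & t ^+ (l.-1 %/ 3) != 1.
Proof.
have l1 := prime_gt1 l_pr; have d3 := dvdn3_pred.
have e0 : (0 < l.-1 %/ 3)%N by rewrite divn_gt0 // dvdn_leq //; lia.
pose rs := enum (predC1 (0 : 'F_l)).
have szrs : size rs = l.-1 by rewrite -cardE cardC1 card_Fp.
have urs : uniq rs by rewrite enum_uniq.
have [ars|/allPn[t]] := boolP (all (l.-1 %/ 3).-unity_root rs).
  have := max_unity_roots e0 ars urs; rewrite szrs.
  by have := @ltn_Pdiv l.-1 3 isT; lia.
by rewrite mem_enum unity_rootE => t0 t1; exists t.
Qed.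

Section CubicChar.
Variables (k : fieldType) (w : k).
Hypothesis prim_w : 3.-primitive_root w.

Definition cubic_char (v : k) (t : 'F_l) : k :=
  if t == 0 then 0 else v ^+ cubic_index t.

Lemma cubic_char0 v : cubic_char v 0 = 0.
Proof. by rewrite /cubic_char eqxx. Qed.

Lemma cubic_charM s t : cubic_char w (s * t) = cubic_char w s * cubic_char w t.
Proof.
rewrite /cubic_char mulf_eq0; have [->|s0] := eqVneq s 0; first by rewrite /= mul0r.
have [->|t0] := eqVneq t 0; first by rewrite /= mulr0.
rewrite /= -exprD; apply/eqP; rewrite (eq_prim_root_expr prim_w).
rewrite -(eq_prim_root_expr prim_c) exprD -!cubic_indexP ?mulf_neq0 //.
by rewrite exprMn.
Qed.

Lemma cubic_char_sqr t : cubic_char (w ^+ 2) t = cubic_char w t ^+ 2.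
Proof.
by rewrite /cubic_char; case: eqP => _; rewrite ?expr0n // exprAC.
Qed.

Lemma cubic_char_cube t : t != 0 -> cubic_char w t ^+ 3 = 1.
Proof.
rewrite /cubic_char => /negPf->.
by rewrite exprAC (prim_expr_order prim_w) expr1n.
Qed.

Lemma cubic_char1 : cubic_char w 1 = 1.
Proof. by rewrite /cubic_char oner_eq0 /cubic_index expr1n eqxx. Qed.

Lemma cubic_charN1 : cubic_char w (-1) = 1.
Proof.
have /eqP := cubic_charM (-1) (-1); rewrite mulrNN mulr1 cubic_char1 => /eqP h.
have := @cubic_char_cube (-1); rewrite oppr_eq0 oner_eq0 => /(_ isT).
by rewrite exprS expr2 -h mulr1.
Qed.

(** Multiplying the variable by a cubic nonresidue multiplies the sum by a cube
    root of unity other than 1. *)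
Lemma sum_cubic_char : \sum_t cubic_char w t = 0.
Proof.
have [a a0 a1] := ex_cubic_nonresidue.
have ca1 : cubic_char w a != 1.
  rewrite /cubic_char (negPf a0) -(expr0 w) (eq_prim_root_expr prim_w).
  by rewrite -(eq_prim_root_expr prim_c) -cubic_indexP.
have : (cubic_char w a - 1) * \sum_t cubic_char w t = 0.
  rewrite mulrBl mul1r {2}(reindex_inj (mulfI a0)) mulr_sumr /=.
  by apply/eqP; rewrite subr_eq0; apply/eqP/eq_bigr => t _; rewrite cubic_charM.
by move/eqP; rewrite mulf_eq0 subr_eq0 (negPf ca1) => /eqP.
Qed.

End CubicChar.

Section Gauss.
Variables (k : fieldType) (w : k).
Hypothesis prim_w : 3.-primitive_root w.

Lemma prim3_sqr : 3.-primitive_root (w ^+ 2).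
Proof. by rewrite (prim_root_exp_coprime _ prim_w). Qed.

Variable z : k.
Hypotheses (zl : z ^+ l = 1) (z1 : z != 1).

Definition add_char (t : 'F_l) : k := z ^+ t.
Definition gauss_sum (v : k) : k := \sum_(t : 'F_l) cubic_char v t * add_char t.
Definition jacobi_sum (v : k) : k :=
  \sum_t cubic_char v t * cubic_char v (1 - t).

Lemma add_charD (s t : 'F_l) : add_char (s + t) = add_char s * add_char t.
Proof.
by rewrite /add_char -exprD -[RHS](expr_mod _ zl) /= -[X in _ = _ ^+ (_ %% X)](Fp_cast l_pr).
Qed.

Lemma add_char0 : add_char 0 = 1. Proof. exact: expr0. Qed.

Lemma add_char1 : add_char 1 = z.
Proof. by rewrite /add_char /= modn_small. Qed.

Lemma sum_add_char (a : 'F_l) : a != 0 -> \sum_(t : 'F_l) add_char (t * a) = 0.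
Proof.
move=> a0; rewrite -(reindex_inj (mulIf a0) (P := xpredT) (F := add_char)).
have : (z - 1) * \sum_(t : 'F_l) add_char t = 0.
  rewrite mulrBl mul1r {2}(reindex_inj (addrI 1)) mulr_sumr /=.
  apply/eqP; rewrite subr_eq0; apply/eqP/eq_bigr => t _. rewrite add_charD.
  by rewrite add_char1.
by move/eqP; rewrite mulf_eq0 subr_eq0 (negPf z1) => /eqP.
Qed.

Lemma gauss_sum_twist (v : k) (a : 'F_l) : 3.-primitive_root v -> a != 0 ->
  cubic_char v a * \sum_t cubic_char v t * add_char (a * t) = gauss_sum v.
Proof.
move=> prim_v a0; rewrite /gauss_sum [RHS](reindex_inj (mulfI a0)) mulr_sumr.
apply: eq_bigr => t _; rewrite mulrA; congr (_ * _).
by rewrite (cubic_charM prim_v).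
Qed.

(** The substitution s = t u in the double sum cancels the multiplicative
    characters of t; summing the additive character over t then selects u = -1. *)
Lemma gauss_sumM : gauss_sum w * gauss_sum (w ^+ 2) = l%:R.
Proof.
rewrite mulrC /gauss_sum mulr_suml.
transitivity (\sum_(t : 'F_l) \sum_u cubic_char w u * add_char (t * (u + 1))).
  apply: eq_bigr => t _; have [->|t0] := eqVneq t 0.
    rewrite cubic_char0 !mul0r -[LHS](sum_cubic_char prim_w).
    by apply: eq_bigr => u _; rewrite mul0r add_char0 mulr1.
  rewrite mulr_sumr (reindex_inj (mulfI t0)); apply: eq_bigr => u _.
  rewrite (cubic_charM prim_w) cubic_char_sqr mulrDr mulr1 add_charD.
  rewrite -[RHS]mul1r -(cubic_char_cube prim_w t0); ring.
rewrite exchange_big (bigD1 (-1)) //= [X in _ + X]big1 ?addr0 => [|u u1].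
  under eq_bigr do rewrite addNr mulr0 add_char0 mulr1.
  by rewrite sumr_const (cubic_charN1 prim_w) card_Fp.
by rewrite -mulr_sumr sum_add_char ?mulr0 // -[1]opprK subr_eq0.
Qed.

(** In the double sum, the terms with s + t = n contribute the Jacobi sum times
    the squared character of n if n is not 0, and a sum of the squared
    character, which vanishes, if n = 0. *)
Lemma gauss_sum_sqr : gauss_sum w ^+ 2 = jacobi_sum w * gauss_sum (w ^+ 2).
Proof.
rewrite expr2 /gauss_sum mulr_suml.
transitivity (\sum_(s : 'F_l) \sum_n cubic_char w s * cubic_char w (n - s) * add_char n).
  apply: eq_bigr => s _; rewrite mulr_sumr (reindex_inj (addIr (- s))).
  apply: eq_bigr => n _.
  have -> : add_char n = add_char (n - s) * add_char s by rewrite -add_charD subrK.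
  by rewrite mulrACA [add_char s * _]mulrC.
rewrite exchange_big mulr_sumr; apply: eq_bigr => n _; rewrite -mulr_suml mulrA.
congr (_ * _); have [->|n0] := eqVneq n 0.
  rewrite cubic_char0 mulr0.
  rewrite -[RHS](sum_cubic_char prim3_sqr); apply: eq_bigr => t _.
  by rewrite sub0r -mulN1r (cubic_charM prim_w) (cubic_charN1 prim_w) // mul1r cubic_char_sqr expr2.
rewrite (reindex_inj (mulfI n0)) mulr_suml; apply: eq_bigr => u _.
rewrite -[X in X - _]mulr1 -mulrBr !(cubic_charM prim_w) cubic_char_sqr; ring.
Qed.

End Gauss.
End CubicCharacter.

Lemma prim3_root (k : fieldType) (w : k) :
  3.-primitive_root w -> w ^+ 2 + w + 1 = 0.
Proof.
move=> pw; have w1 : w - 1 != 0.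
  by rewrite subr_eq0 -{1}(expr1 w) -(expr0 w) (eq_prim_root_expr pw).
apply: (mulfI w1); rewrite mulr0; have := prim_expr_order pw.
by move=> w3; transitivity (w ^+ 3 - 1); [ring | rewrite w3 subrr].
Qed.

Lemma prim3_rootP (k : fieldType) (w : k) :
  3%:R != 0 :> k -> w ^+ 2 + w + 1 = 0 -> 3.-primitive_root w.
Proof.
move=> k3 w0; have w3 : w ^+ 3 = 1.
  apply/eqP; rewrite -subr_eq0; apply/eqP.
  by transitivity ((w - 1) * (w ^+ 2 + w + 1)); [ring | rewrite w0 mulr0].
have [m pm] := prim_order_exists (isT : 0 < 3)%N w3.
case/primeP: (isT : prime 3) => _ /[apply] /orP[] /eqP em; subst m => //.
have w1 : w = 1 by have := prim_expr_order pm; rewrite expr1.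
by case/eqP: k3; rewrite -[RHS]w0 w1; ring.
Qed.

Lemma ex_prim3_root (k : closedFieldType) :
  3%:R != 0 :> k -> exists w : k, 3.-primitive_root w.
Proof.
move=> k3; have [|w] := @closed_rootP k ('X^2 + 'X + 1%:P) _.
  by rewrite size_polyDl ?size_polyDl ?size_polyXn ?size_polyX ?size_polyC ?oner_eq0.
rewrite /root !hornerE => /eqP w0; exists w; apply: prim3_rootP => //.
Qed.

(** A root of 1 + X + ... + X^(l-1) is not 1, because l is invertible. *)
Lemma ex_root_of_unity (k : closedFieldType) (l : nat) : prime l ->
  l%:R != 0 :> k -> exists2 z : k, z ^+ l = 1 & z != 1.
Proof.
move=> lp l0; have [|z] := @closed_rootP k (\poly_(i < l) 1) _.
  rewrite size_poly_eq ?oner_eq0 //; have := prime_gt1 lp; lia.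
rewrite /root horner_poly => /eqP z0; exists z.
  apply/eqP; rewrite -subr_eq0 subrX1.
  under [X in _ * X]eq_bigr do rewrite -[_ ^+ _]mul1r.
  by rewrite z0 mulr0.
apply: contra_neq l0 => z1; rewrite -z0 z1.
under eq_bigr do rewrite mul1r expr1n.
by rewrite sumr_const card_ord.
Qed.

(** The coordinates of w^n in the basis (1, w), for w a primitive cube root of
    unity. *)
Definition eis_re (n : nat) : int :=
  match (n %% 3)%N with 0%N => 1 | 1%N => 0 | _ => -1 end.
Definition eis_im (n : nat) : int :=
  match (n %% 3)%N with 0%N => 0 | 1%N => 1 | _ => -1 end.

Lemma eis_coordE (k : fieldType) (w : k) n : 3.-primitive_root w ->
  w ^+ n = (eis_re n)%:~R + (eis_im n)%:~R * w.
Proof.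
move=> pw; rewrite -(expr_mod _ (prim_expr_order pw)) /eis_re /eis_im.
have := ltn_pmod n (isT : 0 < 3)%N; have := prim3_root pw.
case: (n %% 3)%N => [|[|[|//]]] w0 _ /=; rewrite ?mul0r ?addr0 ?add0r ?mul1r //.
by apply/eqP; rewrite -subr_eq0 -w0; apply/eqP; ring.
Qed.

Section JacobiCoordinates.
Variables (l : nat) (c : 'F_l).
Hypotheses (l_pr : prime l) (prim_c : 3.-primitive_root c).

(** The coordinates of the Jacobi sum in the basis (1, w).  They do not depend on
    the field: an identity between them obtained over the algebraic numbers can
    be used in characteristic q. *)
Definition jacobi_re : int := \sum_(u : 'F_l | (u != 0) && (u != 1))
  eis_re (cubic_index c u + cubic_index c (1 - u)).
Definition jacobi_im : int := \sum_(u : 'F_l | (u != 0) && (u != 1))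
  eis_im (cubic_index c u + cubic_index c (1 - u)).

Lemma jacobi_sumE (k : fieldType) (w : k) : 3.-primitive_root w ->
  jacobi_sum c w = jacobi_re%:~R + jacobi_im%:~R * w.
Proof.
move=> pw; rewrite /jacobi_sum (bigID (fun u : 'F_l => (u != 0) && (u != 1))) /=.
rewrite [X in _ + X]big1 ?addr0 => [|u]; last first.
  rewrite -negb_or negbK => /orP[]/eqP->.
    by rewrite cubic_char0 mul0r.
  by rewrite subrr cubic_char0 mulr0.
rewrite !rmorph_sum mulr_suml -big_split /=; apply: eq_bigr => u /andP[u0 u1].
rewrite -eis_coordE // exprD /cubic_char (negPf u0).
by rewrite subr_eq0 eq_sym (negPf u1).
Qed.

(** Let g, h be the Gauss sums of the character and of its conjugate and J, J'
    the Jacobi sums.  From g^2 = J h, h^2 = J' g and g h = l follows J J' = l. *)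
Lemma jacobi_norm :
  jacobi_re ^+ 2 - jacobi_re * jacobi_im + jacobi_im ^+ 2 = l%:Z.
Proof.
have n0 n : (0 < n)%N -> n%:R != 0 :> algC by rewrite pnatr_eq0 lt0n.
have [w pw] := ex_prim3_root (n0 3 isT).
have l0 := n0 l (prime_gt0 l_pr).
have [z zl z1] := ex_root_of_unity l_pr l0.
have pw2 := prim3_sqr pw.
have := jacobi_sumE pw; have := jacobi_sumE pw2.
have := gauss_sum_sqr l_pr prim_c pw zl.
have := gauss_sum_sqr l_pr prim_c pw2 zl.
have := gauss_sumM l_pr prim_c pw zl z1.
have -> : (w ^+ 2) ^+ 2 = w by rewrite -exprM -{2}(expr1 w) -(expr_mod _ (prim_expr_order pw)).
set g := gauss_sum c z w; set h := gauss_sum c z (w ^+ 2).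
set a := jacobi_re; set b := jacobi_im => gh h2 g2 J2 J1.
have : (a ^+ 2 - a * b + b ^+ 2)%:~R = l%:R :> algC.
  apply: (mulfI l0); rewrite -[in RHS]gh.
  have <- : jacobi_sum c w * jacobi_sum c (w ^+ 2) = (a ^+ 2 - a * b + b ^+ 2)%:~R.
    rewrite J2 J1 !(rmorphD, rmorphN, rmorphM, rmorphXn) /=.
    have := prim3_root pw; move: (a%:~R) (b%:~R) => x y w0.
    apply/eqP; rewrite -subr_eq0; apply/eqP.
    transitivity ((w ^+ 2 + w + 1) * (x * y + y ^+ 2 * (w - 1))); first by ring.
    by rewrite w0 mul0r.
  by rewrite -gh; transitivity (g ^+ 2 * h ^+ 2); [rewrite g2 h2 | ]; ring.
by move/eqP; rewrite -[l%:R]/(l%:Z%:~R) eqr_int => /eqP.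
Qed.

Lemma sum_eis_im : \sum_(u : 'F_l | u != 0) eis_im (cubic_index c u) = 0.
Proof.
have [w pw] := @ex_prim3_root algC (ltac:(by rewrite pnatr_eq0)).
have := sum_cubic_char l_pr prim_c pw.
rewrite (bigD1 0) //= cubic_char0 add0r.
under eq_bigr => u u0 do rewrite /cubic_char (negPf u0) (eis_coordE _ pw).
rewrite big_split -mulr_suml -!rmorph_sum /=.
move: (\sum_(i | i != 0) eis_re _) (\sum_(i | i != 0) eis_im _) => a b ab.
have : (a ^+ 2 - a * b + b ^+ 2)%:~R = 0 :> algC.
  rewrite !(rmorphD, rmorphN, rmorphM, rmorphXn) /=.
  have := prim3_root pw; move: ab; move: (a%:~R) (b%:~R) => x y ab w0.
  transitivity ((w ^+ 2 + w + 1) * (y ^+ 2) + (x + y * w) * (x - y * w - y)); first by ring.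
  by rewrite w0 ab !mul0r addr0.
move/eqP; rewrite intr_eq0 => /eqP; nia.
Qed.

(** The Jacobi sum is primary: (w^i - 1) (w^j - 1) is a multiple of
    (1 - w)^2 = - 3 w, so modulo 3 the term w^(i+j) can be replaced by
    w^i + w^j - 1, and the sums of w^i and w^j over the field vanish. *)
Lemma dvdz3_jacobi_im : (3 %| jacobi_im)%Z.
Proof.
have key : (3 %| (jacobi_im - \sum_(u : 'F_l | (u != 0) && (u != 1))
   (eis_im (cubic_index c u) + eis_im (cubic_index c (1 - u))))%R)%Z.
  rewrite /jacobi_im -sumrB; apply: rpred_sum => u _.
  rewrite /cubic_index; by do 4?case: ifP => _.
have i1 : cubic_index c 1 = 0%N by rewrite /cubic_index expr1n eqxx.
rewrite -[jacobi_im](subrK (\sum_(u : 'F_l | (u != 0) && (u != 1))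
   (eis_im (cubic_index c u) + eis_im (cubic_index c (1 - u))))) rpredD //.
have s1 : \sum_(u : 'F_l | (u != 0) && (u != 1)) eis_im (cubic_index c u) = 0.
  by have := sum_eis_im; rewrite (bigD1 1) ?oner_eq0 //= i1 add0r.
rewrite big_split /= s1 add0r (_ : \sum_(_ | _) _ = 0) ?dvdz0 //.
rewrite -[RHS]s1 [RHS](reindex_inj (inv_inj (subKr 1))) /=.
apply: eq_bigl => u; have -> : (1 - u == 1) = (u == 0).
  by rewrite -[RHS]oppr_eq0 -subr_eq0 addrAC subrr add0r.
by rewrite subr_eq0 andbC [1 == u]eq_sym.
Qed.
End JacobiCoordinates.

(** * Cubic reciprocity between integers and Eisenstein integers *)

(** The cubic residue symbol at the rational prime [q] of an Eisenstein integer
    with reduction [x], whose conjugate has reduction [y].  If q = 1 modulo 3 it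
    is the product of the symbols at the two primes over q, the second one being
    the inverse of the symbol of the conjugate at the first.  If q = 2 modulo 3
    it is x^((q^2-1)/3), and x^q = y. *)
Definition cubic_symbol (k : fieldType) (q : nat) (x y : k) : k :=
  if (q %% 3 == 1)%N then (x / y) ^+ (q.-1 %/ 3) else (y / x) ^+ (q.+1 %/ 3).

Lemma mul3_divn3_pred q : (q %% 3 == 1)%N -> (q.-1 = 3 * (q.-1 %/ 3))%N.
Proof. lia. Qed.

Lemma mul3_divn3_succ q :
  (q %% 3 != 1)%N -> (q %% 3 != 0)%N -> (q.+1 = 3 * (q.+1 %/ 3))%N.
Proof. lia. Qed.

Section Frobenius.
Variables (k : fieldType) (q : nat).
Hypothesis qk : q \in [pchar k].

Lemma frobD (x y : k) : (x + y) ^+ q = x ^+ q + y ^+ q.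
Proof. by rewrite -!(pFrobenius_autE qk) rmorphD. Qed.

Lemma frob_sum (I : finType) (F : I -> k) :
  (\sum_i F i) ^+ q = \sum_i F i ^+ q.
Proof. by rewrite -(pFrobenius_autE qk) rmorph_sum. Qed.

Lemma frob_int (n : int) : n%:~R ^+ q = n%:~R :> k.
Proof. by rewrite -(pFrobenius_autE qk) rmorph_int. Qed.

Lemma pchar_natr_eq0 (n : nat) : (n%:R == 0 :> k) = (q %| n)%N.
Proof. by rewrite (dvdn_pcharf qk). Qed.

Lemma pchar_intr_eq0 (n : int) : (n%:~R == 0 :> k) = (q %| n)%Z.
Proof.
by case: n => n; rewrite ?NegzE ?mulrNz ?oppr_eq0 pchar_natr_eq0 /dvdz ?abszN.
Qed.
End Frobenius.

Section Reciprocity.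
Variables (l : nat) (c : 'F_l).
Hypotheses (l_pr : prime l) (prim_c : 3.-primitive_root c).
Variables (k : closedFieldType) (w : k) (q : nat).
Hypotheses (prim_w : 3.-primitive_root w) (qk : q \in [pchar k]) (ql : q != l).

Lemma pchar_neq3 : q != 3%N.
Proof.
apply/eqP=> q3; have := prim3_root prim_w => w0.
have : (w - 1) ^+ 2 = 0.
  transitivity (w ^+ 2 + w + 1 - 3%:R * w); first by ring.
  by rewrite w0 -{1}q3 (pcharf0 qk) mul0r subrr.
move/eqP; rewrite expf_eq0 subr_eq0 /= -{1}(expr1 w) -(expr0 w).
by rewrite (eq_prim_root_expr prim_w).
Qed.

Lemma add_charX (z : k) n t : z ^+ l = 1 ->
  add_char z (n%:R * t : 'F_l) = add_char z t ^+ n.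
Proof.
move=> zl; elim: n => [|n IH]; first by rewrite mul0r add_char0 expr0.
by rewrite mulrS mulrDl mul1r add_charD // IH exprS.
Qed.

(** In characteristic q, raising a Gauss sum g to the power q raises its terms to
    that power, so the result is the Gauss sum of the q-th power of the character
    times a value of the character at q.  Since g^3 = J^2 J', a power of g is also
    a power of the Jacobi sum J and its conjugate. *)
Lemma jacobi_reciprocity :
  cubic_symbol q ((jacobi_re c)%:~R + (jacobi_im c)%:~R * w)
                 ((jacobi_re c)%:~R + (jacobi_im c)%:~R * w ^+ 2)
  = w ^+ cubic_index c q%:R.
Proof.
have q_pr := pcharf_prime qk; have q3 := pchar_neq3.
have ql0 : (q%:R : 'F_l) != 0.
  by rewrite (pchar_natr_eq0 (pchar_Fp l_pr)) dvdn_prime2 // eq_sym.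
have l0 : l%:R != 0 :> k by rewrite (pchar_natr_eq0 qk) dvdn_prime2.
have [z zl z1] := ex_root_of_unity l_pr l0.
have pw2 := prim3_sqr prim_w.
have w4 : (w ^+ 2) ^+ 2 = w.
  by rewrite -exprM -[RHS]expr1 -(expr_mod _ (prim_expr_order prim_w)).
have := jacobi_sumE c prim_w; have := jacobi_sumE c pw2.
have := gauss_sum_sqr l_pr prim_c prim_w zl.
have := gauss_sum_sqr l_pr prim_c pw2 zl.
have := gauss_sumM l_pr prim_c prim_w zl z1.
have := gauss_sum_twist l_pr prim_c z prim_w ql0.
have := gauss_sum_twist l_pr prim_c z pw2 ql0.
rewrite w4 cubic_char_sqr.
under eq_bigr do rewrite add_charX //.
under [in X in _ -> X]eq_bigr do rewrite add_charX //.
set g := gauss_sum c z w; set h := gauss_sum c z (w ^+ 2).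
have gq : g ^+ q = \sum_t cubic_char c w t ^+ q * add_char z t ^+ q.
  by rewrite /g /gauss_sum (frob_sum qk); apply: eq_bigr => t _; rewrite exprMn.
have <- : cubic_char c w q%:R = w ^+ cubic_index c q%:R.
  by rewrite /cubic_char (negPf ql0).
have u3 : cubic_char c w q%:R ^+ 3 = 1 by apply: cubic_char_cube.
have wq : w ^+ q = if (q %% 3 == 1)%N then w else w ^+ 2.
  rewrite -(expr_mod q (prim_expr_order prim_w)).
  have : (q %% 3 != 0)%N by rewrite -/(3 %| q)%N dvdn_prime2 // eq_sym.
  by have := ltn_pmod q (isT : 0 < 3)%N; case: (q %% 3)%N => [|[|[]]].
have chi_q t : cubic_char c w t ^+ q =
    cubic_char c (if (q %% 3 == 1)%N then w else w ^+ 2) t.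
  rewrite /cubic_char; case: eqP => _; last by rewrite exprAC wq.
  by rewrite expr0n; case: (q) q_pr.
have {gq chi_q} gq : g ^+ q = \sum_t
    cubic_char c (if (q %% 3 == 1)%N then w else w ^+ 2) t * add_char z t ^+ q.
  by rewrite gq; apply: eq_bigr => t _; rewrite chi_q.
move: (cubic_char c w q%:R) u3 => u u3 twh twg gh h2 g2 J2 J1.
have JqE : jacobi_sum c w ^+ q =
    if (q %% 3 == 1)%N then jacobi_sum c w else jacobi_sum c (w ^+ 2).
  rewrite J1 (frobD qk) exprMn !(frob_int qk) wq.
  by case: ifP => _; rewrite ?J1 ?J2.
rewrite -J1 -J2.
move: (jacobi_sum c w) (jacobi_sum c (w ^+ 2)) JqE h2 g2 {J1 J2} => J J' JqE h2 g2.
have g0 : g != 0 by apply: contraNneq l0 => g0; rewrite -gh g0 mul0r.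
(* The two cases below compare g^(q-1) or g^(q+1) with its expression by g^3. *)
have lJ : J * J' = l%:R.
  apply: (mulfI l0); rewrite -gh; transitivity (g ^+ 2 * h ^+ 2); last by ring.
  by rewrite g2 h2; ring.
have g3 : g ^+ 3 = J ^+ 2 * J'.
  by rewrite exprSr g2 -mulrA [h * g]mulrC gh -lJ; ring.
have /andP[J0 J'0] : (J != 0) && (J' != 0) by rewrite -negb_or -mulf_eq0 lJ.
have u0 : u != 0 by apply: contra_eq_neq u3 => ->; rewrite expr0n eq_sym oner_eq0.
have q0 := prime_gt0 q_pr.
rewrite /cubic_symbol; case: ifP => qm in gq JqE *.
  have qe := mul3_divn3_pred qm.
  move: (q.-1 %/ 3)%N qe => e qe.
  have ug : u * (J ^+ 2 * J') ^+ e = 1.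
    apply: (mulIf g0); rewrite -g3 -exprM -qe -mulrA -exprSr prednK // mul1r.
    by rewrite gq twg.
  have Je : J ^+ (3 * e) = 1.
    by apply: (mulfI J0); rewrite -qe -exprS prednK // JqE mulr1.
  apply: (mulIf (expf_neq0 e (mulf_neq0 (expf_neq0 2 J0) J'0))).
  by rewrite ug -exprMn -[RHS]Je exprM; congr (_ ^+ _); field.
have qe : (q.+1 = 3 * (q.+1 %/ 3))%N.
  apply: (mul3_divn3_succ (negbT qm)).
  by rewrite -/(3 %| q)%N dvdn_prime2 // eq_sym.
move: (q.+1 %/ 3)%N qe => e qe.
have ug : u ^+ 2 * (J ^+ 2 * J') ^+ e = J * J'.
  by rewrite lJ -gh -g3 -exprM -qe [g ^+ _]exprSr mulrA gq twh mulrC.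
have Je : J ^+ (3 * e) = J * J' by rewrite -qe exprS JqE.
have JJ : (J ^+ 2 * J') ^+ e * (J / J') ^+ e = J * J'.
  by rewrite -exprMn -Je exprM; congr (_ ^+ _); field.
have JJ0 := expf_neq0 e (mulf_neq0 (expf_neq0 2 J0) J'0).
have uJ : u ^+ 2 = (J / J') ^+ e.
  by apply: (mulIf JJ0); rewrite ug -JJ mulrC.
have -> : J' / J = (J / J')^-1 by rewrite invf_div.
by rewrite exprVn -uJ; apply: (mulfI (expf_neq0 2 u0)); rewrite mulfV ?expf_neq0 // -exprSr.
Qed.
End Reciprocity.

Section CubicSymbol.
Variables (k : fieldType) (q : nat).
Implicit Types x y : k.

Lemma cubic_symbolM x y x' y' :
  cubic_symbol q (x * x') (y * y') = cubic_symbol q x y * cubic_symbol q x' y'.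
Proof. by rewrite /cubic_symbol; case: ifP => _; rewrite -mulf_div exprMn. Qed.

Lemma cubic_symbolV x y : cubic_symbol q y x = (cubic_symbol q x y)^-1.
Proof. by rewrite /cubic_symbol; case: ifP => _; rewrite -exprVn invf_div. Qed.

Lemma cubic_symbol_id x : x != 0 -> cubic_symbol q x x = 1.
Proof. by rewrite /cubic_symbol => x0; rewrite divff // !expr1n if_same. Qed.
End CubicSymbol.

Section IndexArith.
Variables (l : nat) (c : 'F_l).
Hypotheses (l_pr : prime l) (prim_c : 3.-primitive_root c).

Lemma cubic_indexM (s t : 'F_l) : s != 0 -> t != 0 ->
  cubic_index c (s * t) = (cubic_index c s + cubic_index c t)%N %[mod 3].
Proof.
move=> s0 t0; apply/eqP; rewrite -(eq_prim_root_expr prim_c) exprD.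
by rewrite -!cubic_indexP ?mulf_neq0 // exprMn.
Qed.

Lemma cubic_indexN (t : 'F_l) : cubic_index c (- t) = cubic_index c t.
Proof.
have := dvdn3_pred l_pr prim_c; have := prime_gt1 l_pr.
rewrite /cubic_index -mulN1r exprMn -signr_odd => l1 d3.
have -> : odd (l.-1 %/ 3) = false; last by rewrite mul1r.
have [l2|lo] := even_prime l_pr; first by rewrite l2 in d3.
by lia.
Qed.
End IndexArith.

Definition eis_norm (A B : int) : int := A ^+ 2 - A * B + B ^+ 2.

(** A cubic character on the integers prime to [N], written additively modulo 3.
    The second condition expresses periodicity and the fact that -1 is a cube. *)
Definition rational_cubic_character (N : nat) (R : nat -> nat) : Prop :=
  (forall m n, coprime m N -> coprime n N -> R (m * n)%N = (R m + R n)%N %[mod 3]) /\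
  (forall m n, coprime m N -> (N %| m + n)%N -> R m = R n %[mod 3]).

(** The cube root of unity [c] singles out one of the two primes of norm [l] in
    Z[w].  The Jacobi sum is that prime or its conjugate; in the latter case the
    conjugate is taken, which inverts the symbol and gives [s] = 2. *)
Lemma ex_primary_prime (l : nat) (c : 'F_l) : prime l -> 3.-primitive_root c ->
  exists a b : int, exists s : nat,
  [/\ eis_norm a b = l%:Z, (3 %| b)%Z, a%:~R + b%:~R * c = 0 &
  forall (k : closedFieldType) (w : k) q, 3.-primitive_root w ->
    q \in [pchar k] -> q != l ->
    cubic_symbol q (a%:~R + b%:~R * w) (a%:~R + b%:~R * w ^+ 2)
    = w ^+ (s * cubic_index c q%:R)].
Proof.
move=> l_pr prim_c; have nJ := jacobi_norm l_pr prim_c.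
have dJ := dvdz3_jacobi_im l_pr prim_c.
have recJ := @jacobi_reciprocity l c l_pr prim_c.
move: (jacobi_re c) (jacobi_im c) nJ dJ recJ => a b nJ dJ recJ.
have c0 := prim3_root prim_c.
have : (a%:~R + b%:~R * c) * (a%:~R + b%:~R * c ^+ 2) = 0.
  have : (a ^+ 2 - a * b + b ^+ 2)%:~R = 0 :> 'F_l by rewrite nJ; exact: pchar_Fp_0.
  rewrite !(rmorphD, rmorphN, rmorphM, rmorphXn) /=.
  move: (a%:~R) (b%:~R) => x y xy.
  transitivity ((c ^+ 2 + c + 1) * (x * y + y ^+ 2 * (c - 1)) + (x ^+ 2 - x * y + y ^+ 2)).
    by ring.
  by rewrite c0 xy mul0r addr0.
move/eqP; rewrite mulf_eq0 => /orP[]/eqP ac0.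
  by exists a, b, 1%N; split=> // k w q pw qk ql; rewrite mul1n recJ.
have conjE (k : fieldType) (w : k) : w ^+ 2 + w + 1 = 0 ->
  ((a - b)%:~R + (- b)%:~R * w = a%:~R + b%:~R * w ^+ 2) /\
  ((a - b)%:~R + (- b)%:~R * w ^+ 2 = a%:~R + b%:~R * w).
  rewrite !(rmorphD, rmorphN) /=; move: (a%:~R) (b%:~R) => x y w0.
  by split; apply/eqP; rewrite -subr_eq0; apply/eqP;
    [transitivity (- y * (w ^+ 2 + w + 1)) | transitivity (- y * (w ^+ 2 + w + 1))];
    (by ring) || by rewrite w0 mulr0.
exists (a - b), (- b), 2%N; split.
- by rewrite -nJ /eis_norm; ring.
- by rewrite rpredN.
- by have [-> _] := conjE _ _ c0.
move=> k w q pw qk ql; have [-> ->] := conjE _ _ (prim3_root pw).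
rewrite cubic_symbolV recJ //; set i := cubic_index _ _.
have w0 : w != 0 by rewrite (prim_root_eq0 pw).
apply: (mulIf (expf_neq0 i w0)); rewrite mulVf ?expf_neq0 // -exprD.
by rewrite -mulSnr exprM (prim_expr_order pw) expr1n.
Qed.

Lemma eis_normV (F : fieldType) (x y : F) : y != 0 ->
  y ^+ 2 * ((- x / y) ^+ 2 + - x / y + 1) = x ^+ 2 - x * y + y ^+ 2.
Proof. by move=> y0; field. Qed.

(** Induction on the norm.  A prime l dividing the norm determines a cube root of
    unity modulo l, namely -A / B, hence a primary prime of norm l that divides
    A + B w; it contributes the cubic character modulo l to [R].  The condition on
    B leaves only 1 and -1, whose symbols are trivial, among the elements of
    norm 1. *)
Lemma cubic_reciprocity (A B : int) : coprimez A B -> (3 %| B)%Z ->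
  exists2 R : nat -> nat, rational_cubic_character `|eis_norm A B| R &
  forall (k : closedFieldType) (w : k) q, 3.-primitive_root w ->
    q \in [pchar k] -> ~~ (q %| `|eis_norm A B|)%N ->
    cubic_symbol q (A%:~R + B%:~R * w) (A%:~R + B%:~R * w ^+ 2) = w ^+ R q.
Proof.
have [n] := ubnP `|eis_norm A B|%N; elim: n => // n IH in A B *.
rewrite ltnS => leN cAB B3.
have N0 : 0 < eis_norm A B.
  have : (A != 0) || (B != 0).
    by rewrite -negb_and; apply/negP => /andP[/eqP A0 /eqP B0]; rewrite A0 B0 in cAB.
  rewrite /eis_norm; nia.
have [N1|N1] := eqVneq `|eis_norm A B|%N 1%N.
  have [B0 A1] : B = 0 /\ (A = 1 \/ A = -1).
    by case/dvdzP: B3 => B' B3; rewrite /eis_norm in N1; subst B; split; nia.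
  exists (fun=> 0%N); first by split=> *; rewrite ?addn0.
  move=> k w q _ _ _; rewrite B0 !mul0r !addr0 cubic_symbol_id ?expr0 //.
  by case: A1 => ->; rewrite ?rmorphN ?oppr_eq0 oner_eq0.
have lt1N : (1 < `|eis_norm A B|)%N by lia.
pose l := pdiv `|eis_norm A B|; have l_pr : prime l by exact: pdiv_prime.
have lN : (l %| eis_norm A B)%Z by exact: pdiv_dvd.
have dFp n : (n%:~R == 0 :> 'F_l) = (l %| n)%Z := pchar_intr_eq0 (pchar_Fp l_pr) n.
have ndvd (m : nat) : prime m -> (m %| A)%Z -> ~~ (m %| B)%Z.
  move=> m_pr mA; apply/negP=> mB.
  have : (m %| gcdz A B)%Z by rewrite dvdz_gcd mA.
  by rewrite (eqP cAB) dvdz1 => /eqP /= m1; move: m_pr; rewrite m1.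
have pexp (m : nat) (x : int) : prime m -> (m %| x ^+ 2)%Z -> (m %| x)%Z.
  by move=> m_pr; rewrite !dvdzE abszX Euclid_dvdX // => /andP[].
have lB : ~~ (l %| B)%Z.
  apply/negP=> lB; have lA : (l %| A)%Z.
    apply: pexp => //; rewrite (_ : A ^+ 2 = eis_norm A B + B * (A - B)).
      by rewrite rpredD // dvdz_mulr.
    by rewrite /eis_norm; ring.
  by have := ndvd _ l_pr lA; rewrite lB.
have l3 : l != 3%N.
  apply/eqP=> l3; have A3 : (3%N %| A)%Z.
    apply: pexp => //; rewrite (_ : A ^+ 2 = eis_norm A B + B * (A - B)).
      by rewrite rpredD ?dvdz_mulr // -l3.
    by rewrite /eis_norm; ring.
  by have := ndvd 3%N isT A3; rewrite B3.
have B0 : (B%:~R : 'F_l) != 0 by rewrite dFp.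
pose c : 'F_l := - A%:~R / B%:~R.
have Ac : A%:~R + B%:~R * c = 0 by rewrite /c mulrC divfK // subrr.
have prim_c : 3.-primitive_root c.
  apply: prim3_rootP.
    by rewrite (pchar_natr_eq0 (pchar_Fp l_pr)) dvdn_prime2.
  apply: (mulfI (expf_neq0 2 B0)); rewrite mulr0 eis_normV //.
  have : (eis_norm A B)%:~R == 0 :> 'F_l by rewrite dFp.
  by rewrite /eis_norm !(rmorphD, rmorphN, rmorphM, rmorphXn) /= => /eqP.
have [a [b [s [nab b3 abc recl]]]] := ex_primary_prime l_pr prim_c.
have [A' A'E] : exists A', A * (a - b) + B * b = A' * l%:Z.
  apply/dvdzP; rewrite -dFp !(rmorphD, rmorphN, rmorphM) /=.
  rewrite (_ : A%:~R = - (B%:~R * c)); last by apply/eqP; rewrite -addr_eq0 Ac.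
  rewrite (_ : a%:~R = - (b%:~R * c)); last by apply/eqP; rewrite -addr_eq0 abc.
  apply/eqP; move: (B%:~R) (b%:~R) => x y.
  transitivity (x * y * (c ^+ 2 + c + 1)); [by ring | by rewrite (prim3_root prim_c) mulr0].
have [B' B'E] : exists B', B * a - A * b = B' * l%:Z.
  apply/dvdzP; rewrite -dFp !(rmorphD, rmorphN, rmorphM) /=.
  rewrite (_ : A%:~R = - (B%:~R * c)); last by apply/eqP; rewrite -addr_eq0 Ac.
  rewrite (_ : a%:~R = - (b%:~R * c)); last by apply/eqP; rewrite -addr_eq0 abc.
  by apply/eqP; ring.
have lZ0 : l%:Z != 0 by have := prime_gt0 l_pr; lia.
have AE : A = a * A' - b * B'.
  apply: (mulfI lZ0); transitivity (a * (A' * l%:Z) - b * (B' * l%:Z)); last by ring.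
  by rewrite -A'E -B'E -nab /eis_norm; ring.
have BE : B = A' * b + B' * a - B' * b.
  apply: (mulfI lZ0); transitivity (b * (A' * l%:Z) + (a - b) * (B' * l%:Z)); last by ring.
  by rewrite -A'E -B'E -nab /eis_norm; ring.
have NE : eis_norm A B = l%:Z * eis_norm A' B'.
  by rewrite -nab AE BE /eis_norm; ring.
have NEn : `|eis_norm A B|%N = (l * `|eis_norm A' B'|)%N by rewrite NE abszM.
have N'0 : (0 < `|eis_norm A' B'|)%N by move: NEn N0; case: (`|_|%N) => //; lia.
have [|||R [RM RN] Rs] := IH A' B'.
- by have := prime_gt1 l_pr; nia.
- have dv (m : int) : (m %| A')%Z -> (m %| B')%Z -> (m %| 1)%Z.
    move=> mA mB; have : (m %| gcdz A B)%Z; last by rewrite (eqP cAB).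
    rewrite dvdz_gcd AE BE [A' * b]mulrC [B' * a]mulrC [B' * b]mulrC.
    by rewrite !(rpredB, rpredD) // dvdz_mull.
  by have := dv _ (dvdz_gcdl A' B') (dvdz_gcdr A' B'); rewrite dvdz1 coprimezE.
- have : (3 %| B' * l%:Z)%Z by rewrite -B'E; apply: rpredB; [exact: dvdz_mulr | exact: dvdz_mull].
  by rewrite Gauss_dvdzl // coprimezE /= prime_coprime // dvdn_prime2 // eq_sym.
exists (fun m => (R m + s * cubic_index c m%:R)%N).
  have c0 m : coprime m `|eis_norm A B| -> (m%:R : 'F_l) != 0.
    rewrite NEn coprimeMr (pchar_natr_eq0 (pchar_Fp l_pr)) => /andP[+ _].
    by rewrite coprime_sym prime_coprime.
  have cN m : coprime m `|eis_norm A B| -> coprime m `|eis_norm A' B'|.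
    by rewrite NEn coprimeMr => /andP[].
  split=> m1 m2 cm1.
    move=> cm2; rewrite natrM addnACA -mulnDr -modnDml RM ?cN // modnDml.
    by apply/eqP; rewrite eqn_modDl -modnMmr cubic_indexM ?c0 // modnMmr.
  move=> dvN; have m12 : m1%:R = - m2%:R :> 'F_l.
    apply/eqP; rewrite -addr_eq0 -natrD (pchar_natr_eq0 (pchar_Fp l_pr)).
    by apply: dvdn_trans dvN; rewrite NEn dvdn_mulr.
  rewrite m12 cubic_indexN // -modnDml (RN _ m2) ?cN ?modnDml //.
  by apply: dvdn_trans dvN; rewrite NEn dvdn_mull.
move=> k w q pw qk; rewrite NEn Euclid_dvdM ?(pcharf_prime qk) // negb_or.
case/andP=> ql qN'; rewrite exprD -(Rs k w q pw qk qN') -recl //; last first.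
  by rewrite -dvdn_prime2 // (pcharf_prime qk).
rewrite -cubic_symbolM; congr cubic_symbol.
  rewrite {1}AE {1}BE !(rmorphD, rmorphN, rmorphM) /=.
  have := prim3_root pw; move: (A'%:~R) (B'%:~R) (a%:~R) (b%:~R) => x y x' y' w0.
  apply/eqP; rewrite -subr_eq0; apply/eqP.
  by transitivity (- y * y' * (w ^+ 2 + w + 1)); [ring | rewrite w0 mulr0].
rewrite {1}AE {1}BE !(rmorphD, rmorphN, rmorphM) /=.
have := prim3_root pw; move: (A'%:~R) (B'%:~R) (a%:~R) (b%:~R) => x y x' y' w0.
apply/eqP; rewrite -subr_eq0; apply/eqP.
by transitivity (- y * y' * (w ^+ 2 + w + 1) * (w ^+ 2 - w + 1)); [ring | rewrite w0 mulr0 mul0r].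
Qed.

(** * The cubic character at the values of x^2 + 11 y^2 *)

Lemma ex_closed_pchar (q : nat) : prime q ->
  exists k : closedFieldType, q \in [pchar k].
Proof.
move=> q_pr; have [k [f _]] := countable_algebraic_closure 'F_q.
by exists k; rewrite (fmorph_pchar f) pchar_Fp.
Qed.

Lemma closed_pchar_prim3 (k : closedFieldType) q : q \in [pchar k] ->
  q != 3%N -> exists w : k, 3.-primitive_root w.
Proof.
move=> qk q3; apply: ex_prim3_root.
by rewrite (pchar_natr_eq0 qk) dvdn_prime2 // (pcharf_prime qk).
Qed.

Lemma prim3_sqrtN3 (k : fieldType) (w : k) : 3.-primitive_root w ->
  (1 + 2%:R * w) ^+ 2 = - 3%:R.
Proof.
move=> /prim3_root w0; apply/eqP; rewrite -subr_eq0; apply/eqP.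
by transitivity (4%:R * (w ^+ 2 + w + 1)); [ring | rewrite w0 mulr0].
Qed.

Lemma prim3_sqrtN3_conj (k : fieldType) (w : k) : 3.-primitive_root w ->
  1 + 2%:R * w ^+ 2 = - (1 + 2%:R * w).
Proof.
move=> /prim3_root w0; apply/eqP; rewrite -subr_eq0; apply/eqP.
by transitivity (2%:R * (w ^+ 2 + w + 1)); [ring | rewrite w0 mulr0].
Qed.

Lemma cubic_symbol_scale (k : fieldType) q (x y z : k) : z != 0 ->
  cubic_symbol q (z * x) (z * y) = cubic_symbol q x y.
Proof. by move=> z0; rewrite cubic_symbolM cubic_symbol_id // mul1r. Qed.

(** The symbol is a power of -1 whose exponent is even, unless q = 2, where
    -1 = 1. *)
Lemma cubic_symbol_opp (k : fieldType) q (x : k) : q \in [pchar k] ->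
  q != 3%N -> x != 0 -> cubic_symbol q x (- x) = 1.
Proof.
move=> qk q3 x0; have q_pr := pcharf_prime qk.
have [q2|qo] := even_prime q_pr.
  rewrite (_ : - x = x) ?cubic_symbol_id //; apply/eqP; rewrite eq_sym -addr_eq0.
  by rewrite -mulr2n -mulr_natl; move: (pcharf0 qk); rewrite q2 => ->; rewrite mul0r.
have qm : (q %% 3 != 0)%N by rewrite -/(3 %| q)%N dvdn_prime2 // eq_sym.
have e1 : (q %% 3 == 1)%N -> odd (q.-1 %/ 3) = false by lia.
have e2 : (q %% 3 != 1)%N -> odd (q.+1 %/ 3) = false by lia.
rewrite /cubic_symbol invrN mulrN mulNr divff //.
by case: ifPn => [/e1|/e2]; rewrite -signr_odd => ->.
Qed.

(** Cardano's formula for X^3 - X^2 - X - 1 involves the cube roots of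
    19 + 3 sqrt(33) and 19 - 3 sqrt(33); when t^2 = -11, the product of t and
    1 + 2 w, whose square is -3, is a square root of 33. *)
Definition cardano_symbol (k : fieldType) (q : nat) (w t : k) : k :=
  cubic_symbol q (19%:R + 3%:R * (1 + 2%:R * w) * t)
                 (19%:R - 3%:R * (1 + 2%:R * w) * t).

Lemma rational_cubic_character_trivial N R n : rational_cubic_character N R ->
  (0 < n)%N -> coprime n N ->
  (forall q, prime q -> (q %| n)%N -> (3 %| R q)%N) -> (3 %| R n)%N.
Proof.
case=> RM _; have [m] := ubnP n; elim: m => // m IH in n *.
rewrite ltnS => lenm n0 cn Rq.
have [n1|n1] := leqP n 1%N.
  have -> : n = 1%N by lia.
  have := RM 1%N 1%N (coprime1n _) (coprime1n _); rewrite muln1 /dvdn; lia.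
have p_pr := pdiv_prime n1; have pn := pdiv_dvd n.
have nE := divnK pn; set d := (n %/ pdiv n)%N in nE.
have cd : coprime d N /\ coprime (pdiv n) N.
  by apply/andP; rewrite -coprimeMl nE.
have ltd : (d < n)%N by rewrite ltn_Pdiv ?prime_gt1.
have d0 : (0 < d)%N by move: n0; rewrite -nE; case: (d).
have Rd : (3 %| R d)%N.
  apply: IH => //; [lia | by case: cd | move=> q q_pr qd; apply: Rq => //].
  by rewrite -nE dvdn_mulr.
have Rp := Rq _ p_pr pn.
by rewrite -nE /dvdn RM ?cd.1 ?cd.2 // -/(dvdn _ _) dvdn_addl.
Qed.

Lemma coprimez_no_common_prime (q : nat) (X y : int) : prime q -> coprimez X y ->
  (q %| X)%Z -> (q %| y)%Z -> False.
Proof.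
move=> q_pr cXy qX qy; have : (q %| gcdz X y)%Z by rewrite dvdz_gcd qX.
by rewrite (eqP cXy) dvdz1 => /eqP /= q1; move: q_pr; rewrite q1.
Qed.

Lemma Euclid_dvdzM (q : nat) (x y : int) : prime q ->
  (q %| x * y)%Z = (q %| x)%Z || (q %| y)%Z.
Proof. by move=> q_pr; rewrite !dvdzE abszM Euclid_dvdM. Qed.

Lemma Euclid_dvdz_sqr (q : nat) (x : int) : prime q ->
  (q %| x ^+ 2)%Z = (q %| x)%Z.
Proof. by move=> q_pr; rewrite expr2 Euclid_dvdzM // orbb. Qed.

Definition form11 (X y : int) : int := X ^+ 2 + 11 * y ^+ 2.

Lemma form11_ge0 X y : 0 <= form11 X y.
Proof. rewrite /form11; nia. Qed.

Lemma coprime_no_common_prime (m N : nat) : (0 < m)%N || (0 < N)%N ->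
  (forall q, prime q -> (q %| m)%N -> ~~ (q %| N)%N) -> coprime m N.
Proof.
move=> m0 mN; have g0 : (0 < gcdn m N)%N by rewrite gcdn_gt0.
have [g1|g1] := leqP (gcdn m N) 1; first by rewrite /coprime eqn_leq g1.
have := mN _ (pdiv_prime g1) (dvdn_trans (pdiv_dvd _) (dvdn_gcdl m N)).
by rewrite (dvdn_trans (pdiv_dvd _) (dvdn_gcdr m N)).
Qed.

(** Since 27, 64 and -1 are cubes, m has the same image as y^2. *)
Lemma cubic_character_norm_relation N R y m : rational_cubic_character N R ->
  coprime 2 N -> coprime 3 N -> coprime y N -> coprime m N ->
  (N %| 27 * m + 64 * (y * y))%N -> (3 %| R y)%N -> (3 %| R m)%N.
Proof.
move=> [RM RN] c2 c3 cy cm Nd Ry.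
have c4 : coprime 4 N := coprimeXl 2 c2.
have c8 : coprime 8 N := coprimeXl 3 c2.
have c64 : coprime 64 N := coprimeXl 6 c2.
have c9 : coprime 9 N := coprimeXl 2 c3.
have c27 : coprime 27 N := coprimeXl 3 c3.
have := RN (27 * m)%N (64 * (y * y))%N; rewrite coprimeMl c27 cm => /(_ isT Nd).
have := RM _ _ c27 cm; have := RM _ _ cy cy.
have := RM 64%N (y * y)%N c64; rewrite coprimeMl cy => /(_ isT).
have : R 27%N = (R 9%N + R 3%N)%N %[mod 3] := RM 9%N 3%N c9 c3.
have : R 9%N = (R 3%N + R 3%N)%N %[mod 3] := RM 3%N 3%N c3 c3.
have : R 64%N = (R 8%N + R 8%N)%N %[mod 3] := RM 8%N 8%N c8 c8.
have : R 8%N = (R 4%N + R 2%N)%N %[mod 3] := RM 4%N 2%N c4 c2.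
have : R 4%N = (R 2%N + R 2%N)%N %[mod 3] := RM 2%N 2%N c2 c2.
move: Ry; clear; lia.
Qed.

(** Let m = X^2 + 11 y^2.  The element 19 y + 3 (1 + 2 w) X = A + B w has norm
    27 m + 64 y^2, so a character [R] given by reciprocity sends m to the same
    value as y^2.  At a prime dividing y the element is a multiple of 1 + 2 w,
    hence opposite to its conjugate, and its symbol is trivial.  Reciprocity is
    applied after division by the greatest common divisor [g] of A and B; that y
    is prime to 3 makes it primary. *)
Lemma norm_form_character_coprime3 (X y : int) :
  coprimez X y -> ~~ (3 %| y)%Z -> odd `|form11 X y| ->
  exists R : nat -> nat,
  [/\ forall m n, (m * n %| `|form11 X y|)%N -> R (m * n)%N = (R m + R n)%N %[mod 3],
      (3 %| R `|form11 X y|%N)%N &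
  forall (q : nat) (k : closedFieldType) (w : k), q \in [pchar k] ->
    (q %| `|form11 X y|)%N -> q != 3%N -> 3.-primitive_root w ->
    cardano_symbol q w (X%:~R / y%:~R) = w ^+ R q].
Proof.
move=> cXy y3 mo; have m0 := form11_ge0 X y.
have mE : (`|form11 X y|%N)%:Z = X ^+ 2 + 11 * y ^+ 2 by rewrite gez0_abs.
move: (`|form11 X y|%N) mE mo => m mE mo {m0}.
have m0 : (0 < m)%N by case: (m) mo.
pose A := 19 * y + 3 * X; pose B := 6 * X; pose g := gcdz A B.
have A3 : ~~ (3%N %| A)%Z.
  have d3 : (3%N %| 3 * X)%Z by rewrite dvdz_mulr.
  by rewrite /A rpredDr // Euclid_dvdzM.
have [A' AE] : exists A', A = g * A'.
  by have /dvdzP[A' ->] := dvdz_gcdl A B; exists A'; rewrite mulrC.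
have [B' BE] : exists B', B = g * B'.
  by have /dvdzP[B' ->] := dvdz_gcdr A B; exists B'; rewrite mulrC.
have g0 : g != 0.
  by apply: contraNneq A3; rewrite AE => ->; rewrite mul0r dvdz0.
have g3 : ~~ (3%N %| g)%Z by apply: contra A3; rewrite AE => /dvdz_mulr->.
have cAB : coprimez A' B'.
  have : g * gcdz A' B' = g * 1.
    have -> : g * gcdz A' B' = gcdz (g * A') (g * B') by rewrite -mulz_gcdr.
    by rewrite mulr1 -AE -BE.
  by move/(mulfI g0)/eqP.
have B3 : (3%N %| B')%Z.
  have : (3%N %| g * B')%Z by rewrite -BE /B (_ : 6 = 3%N%:Z * 2) // -mulrA dvdz_mulr.
  by rewrite Euclid_dvdzM // (negPf g3).
have [R [RM RN] Rs] := cubic_reciprocity cAB B3.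
have NE : g ^+ 2 * eis_norm A' B' = 27 * m%:Z + 64 * y ^+ 2.
  have -> : g ^+ 2 * eis_norm A' B' = eis_norm A B by rewrite AE BE /eis_norm; ring.
  by rewrite mE /eis_norm /A /B; ring.
(* Divisibility of the norm by a prime other than 3 that divides y or m would
   contradict the coprimality of X and y, or the parity of m. *)
have dvN q : prime q -> q != 3%N -> (q %| (27 * m%:Z + 64 * y ^+ 2)%R)%Z ->
    (q %| y)%Z || (q %| m)%N -> False.
  move=> q_pr q3 q27 qym.
  have q27' : ~~ (q %| 27%R)%Z.
    by rewrite (_ : 27 = (3%N : int) ^+ 3) // dvdzE abszX Euclid_dvdX //= dvdn_prime2 // andbT.
  have qX2 : (q %| (X ^+ 2 + 11 * y ^+ 2)%R)%Z -> (q %| y)%Z -> False.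
    move=> qm qy; apply: (coprimez_no_common_prime q_pr cXy _ qy).
    have qy2 : (q %| (11 * y ^+ 2)%R)%Z by rewrite dvdz_mull // Euclid_dvdz_sqr.
    by move: qm; rewrite rpredDr // Euclid_dvdz_sqr.
  case/orP: qym => [qy|qm].
    apply: (qX2 _ qy); rewrite -mE.
    have qy2 : (q %| (64 * y ^+ 2)%R)%Z by rewrite dvdz_mull // Euclid_dvdz_sqr.
    by move: q27; rewrite rpredDr // Euclid_dvdzM // (negPf q27').
  apply: (qX2); first by rewrite -mE.
  have qm27 : (q %| (27 * m%:Z)%R)%Z by rewrite dvdz_mull.
  move: q27; rewrite rpredDl // Euclid_dvdzM // Euclid_dvdz_sqr // => /orP[|//].
  rewrite (_ : 64 = (2%N : int) ^+ 6) // dvdzE abszX Euclid_dvdX //= dvdn_prime2 //.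
  by rewrite andbT => /eqP q2; rewrite q2 dvdn2 mo in qm.
have n3 : ~~ (3%N %| eis_norm A' B')%Z.
  apply/negP=> n3; move/negP: y3; rewrite -(Euclid_dvdz_sqr y (isT : prime 3)); apply.
  have : (3%N %| (27 * m%:Z + 64 * y ^+ 2)%R)%Z by rewrite -NE dvdz_mull.
  have d27 : (3%N %| (27 * m%:Z)%R)%Z by rewrite dvdz_mulr.
  by rewrite rpredDl // Euclid_dvdzM //= => ->.
have n2 : ~~ (2%N %| eis_norm A' B')%Z.
  apply/negP=> n2; have : (2%N %| (27 * m%:Z + 64 * y ^+ 2)%R)%Z by rewrite -NE dvdz_mull.
  have d64 : (2%N %| (64 * y ^+ 2)%R)%Z by rewrite dvdz_mulr.
  by rewrite rpredDr // Euclid_dvdzM //= dvdzE dvdn2 /= mo.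
have y0 : (0 < `|y|)%N by rewrite absz_gt0; apply: contraNneq y3 => ->; exact: dvdz0.
have cyN : coprime `|y| `|eis_norm A' B'|.
  apply: coprime_no_common_prime => [|q q_pr qy]; first (by rewrite y0); apply/negP => qN.
  apply: (dvN q) => //; [|by rewrite -NE dvdz_mull|by rewrite dvdzE qy].
  by apply/eqP => q3; case/negP: y3; rewrite q3 in qy.
have cmN : coprime m `|eis_norm A' B'|.
  apply: coprime_no_common_prime => [|q q_pr qm]; first by rewrite m0.
  have [->|q3] := eqVneq q 3%N => //.
  by apply/negP => qN; apply: (dvN q); rewrite ?qm ?orbT // -NE dvdz_mull.
have c2N : coprime 2 `|eis_norm A' B'| by rewrite prime_coprime.
have c3N : coprime 3 `|eis_norm A' B'| by rewrite prime_coprime.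
have gE (k : fieldType) (w : k) : g%:~R * (A'%:~R + B'%:~R * w) =
    19%:R * y%:~R + 3%:R * (1 + 2%:R * w) * X%:~R.
  rewrite mulrDr mulrA -!rmorphM /= -AE -BE /A /B.
  by rewrite !(rmorphD, rmorphM) /=; ring.
have Ry : (3 %| R `|y|%N)%N.
  apply: (@rational_cubic_character_trivial `|eis_norm A' B'|) => // q q_pr qy.
  have [k qk] := ex_closed_pchar q_pr.
  have q3 : q != 3%N by apply/eqP => q3; case/negP: y3; rewrite q3 in qy.
  have [w pw] := closed_pchar_prim3 qk q3.
  have qN : ~~ (q %| `|eis_norm A' B'|)%N.
    by apply/negP => qN; apply: (dvN q); rewrite ?dvdzE ?qy // -dvdzE -NE dvdz_mull.
  have X0 : X%:~R != 0 :> k.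
    rewrite (pchar_intr_eq0 qk); apply/negP => qX.
    exact: (coprimez_no_common_prime q_pr cXy qX qy).
  have g0k : g%:~R != 0 :> k.
    rewrite (pchar_intr_eq0 qk); apply/negP => qg.
    by apply: (dvN q); rewrite ?dvdzE ?qy // -dvdzE -NE dvdz_mulr // dvdz_mulr.
  have y0k : y%:~R = 0 :> k by apply/eqP; rewrite (pchar_intr_eq0 qk).
  rewrite (prim_order_dvd pw) -Rs // -(cubic_symbol_scale _ _ _ g0k) !gE y0k.
  rewrite prim3_sqrtN3_conj // mulr0 !add0r mulrN mulNr cubic_symbol_opp //.
  have k3 : 3%:R != 0 :> k by rewrite (pchar_natr_eq0 qk) dvdn_prime2.
  rewrite !mulf_neq0 //; apply: contra_eq_neq (prim3_sqrtN3 pw) => ->.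
  by rewrite expr0n eq_sym oppr_eq0.
exists R; split.
- move=> a b /coprime_dvdl/(_ cmN); rewrite coprimeMl => /andP[ca cb].
  exact: RM.
- apply: (@cubic_character_norm_relation `|eis_norm A' B'| R `|y|) => //.
  suff : (eis_norm A' B' %| (27 * m + 64 * (`|y| * `|y|))%N%:Z)%Z by [].
  rewrite PoszD !PoszM (_ : `|y|%N%:Z * _ = y ^+ 2) -?NE ?dvdz_mull //.
  by rewrite -expr2 abszE real_normK ?num_real.
move=> q k w qk qm q3 pw; have q_pr := pcharf_prime qk.
have qN : ~~ (q %| `|eis_norm A' B'|)%N.
  by apply/negP => qN; apply: (dvN q); rewrite ?qm ?orbT // -NE dvdz_mull.
have y0k : y%:~R != 0 :> k.
  rewrite (pchar_intr_eq0 qk); apply/negP => qy; apply: (dvN q); rewrite ?qy //.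
  by rewrite rpredD ?dvdz_mull // Euclid_dvdz_sqr.
have g0k : g%:~R != 0 :> k.
  rewrite (pchar_intr_eq0 qk); apply/negP => qg; apply: (dvN q); rewrite ?qm ?orbT //.
  by rewrite -NE dvdz_mulr // dvdz_mulr.
rewrite -Rs // -(cubic_symbol_scale _ _ _ g0k) !gE prim3_sqrtN3_conj //.
rewrite /cardano_symbol -(cubic_symbol_scale _ _ _ y0k); congr cubic_symbol; field => //.
Qed.

(** The fourth power of 19 + 18 sqrt(-3) is rational modulo 47. *)
Lemma cardano_symbol47 (k : fieldType) (w : k) : 47%N \in [pchar k] ->
  3.-primitive_root w -> cardano_symbol 47 w 6%:R = 1.
Proof.
move=> k47 pw; have n0 (n : nat) : (0 < n < 47)%N -> n%:R != 0 :> k.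
  by move=> ?; rewrite (pchar_natr_eq0 k47) gtnNdvd //; lia.
rewrite /cardano_symbol /cubic_symbol /=.
have r2 := prim3_sqrtN3 pw; move: (1 + 2%:R * w) r2 => r r2.
have r0 : r != 0.
  apply: contra_eq_neq r2 => ->; rewrite expr0n eq_sym oppr_eq0; exact: n0.
have k0 : 47%:R = 0 :> k := pcharf0 k47.
have -> : (48 %/ 3 = 4 * 4)%N by [].
have sq (x : k) : x ^+ 2 = - 3%:R -> (19%:R + 3%:R * x * 6%:R) ^+ 2 = 26%:R * x.
  move=> x2; transitivity (19%:R ^+ 2 + 18%:R ^+ 2 * x ^+ 2 + 26%:R * x + 47%:R * 14%:R * x).
    by ring.
  rewrite x2 k0 (_ : _ ^+ 2 + _ = - 13%:R * 47%:R); last by ring.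
  by rewrite k0; ring.
have sq4 (x : k) : x ^+ 2 = - 3%:R -> (19%:R + 3%:R * x * 6%:R) ^+ 4 = - 3%:R * 26%:R ^+ 2.
  move=> x2; rewrite (exprM _ 2 2) sq // exprMn x2; ring.
have -> : 19%:R - 3%:R * r * 6%:R = 19%:R + 3%:R * (- r) * 6%:R by ring.
rewrite exprM expr_div_n !sq4 ?sqrrN // divff ?expr1n //.
by rewrite mulf_neq0 ?expf_neq0 ?oppr_eq0 ?n0.
Qed.

(** The exponent is 2, and the squares of 19 + 3 sqrt(33) and 19 - 3 sqrt(33)
    differ by a multiple of sqrt(33) that is prime to 5. *)
Lemma cardano_symbol5 (k : fieldType) (w t : k) : 5%N \in [pchar k] ->
  3.-primitive_root w -> t ^+ 2 = - 11%:R -> cardano_symbol 5 w t != 1.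
Proof.
move=> k5 pw t2; have n0 (n : nat) : ~~ (5 %| n)%N -> n%:R != 0 :> k.
  by rewrite (pchar_natr_eq0 k5).
have r2 := prim3_sqrtN3 pw; rewrite /cardano_symbol /cubic_symbol /=.
move: (1 + 2%:R * w) r2 => r r2.
have xy : (19%:R + 3%:R * r * t) * (19%:R - 3%:R * r * t) = 64%:R.
  transitivity (361%:R - 9%:R * (r ^+ 2 * t ^+ 2)); first by ring.
  by rewrite r2 t2; ring.
have : (19%:R + 3%:R * r * t) * (19%:R - 3%:R * r * t) != 0 by rewrite xy n0.
rewrite mulf_eq0 negb_or => /andP[x0 y0].
have -> : (6 %/ 3 = 2)%N by [].
rewrite expr_div_n -[X in _ != X](divff (expf_neq0 2 x0)).
rewrite (inj_eq (mulIf _)) ?invr_eq0 ?expf_neq0 //.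
rewrite -subr_eq0 (_ : _ - _ = - 228%:R * (r * t)); last by ring.
have rt2 : (r * t) ^+ 2 = 33%:R by rewrite exprMn r2 t2; ring.
rewrite mulf_neq0 ?oppr_eq0 ?n0 //; apply: contra_eq_neq rt2 => ->.
by rewrite expr0n eq_sym n0.
Qed.

(** If 3 divides y, X + y sqrt(-11) is multiplied by 6 + sqrt(-11), of norm 47.
    The new y is prime to 3; the ratio X / y is unchanged modulo the primes
    dividing m, since there it is a square root of -11; and the factor 47 has
    trivial symbol. *)
Lemma norm_form_character (X y : int) :
  coprimez X y -> odd `|form11 X y| -> ~~ (3 %| `|form11 X y|)%N ->
  ~~ (47 %| `|form11 X y|)%N ->
  exists R : nat -> nat,
  [/\ forall m n, (m * n %| `|form11 X y|)%N -> R (m * n)%N = (R m + R n)%N %[mod 3],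
      (3 %| R `|form11 X y|%N)%N &
  forall (q : nat) (k : closedFieldType) (w : k), q \in [pchar k] ->
    (q %| `|form11 X y|)%N -> 3.-primitive_root w ->
    cardano_symbol q w (X%:~R / y%:~R) = w ^+ R q].
Proof.
move=> cXy mo m3 m47; have [y3|y3] := boolP (3%N %| y)%Z; last first.
  have [R [RM R3 Rs]] := norm_form_character_coprime3 cXy y3 mo.
  exists R; split=> // q k w qk qm pw; apply: Rs => //.
  by apply: contraNneq m3 => <-.
pose X' := 6 * X - 11 * y; pose y' := X + 6 * y.
have fE : form11 X' y' = 47 * form11 X y by rewrite /form11 /X' /y'; ring.
have fEn : `|form11 X' y'|%N = (47 * `|form11 X y|)%N by rewrite fE abszM.
have XE : 47 * X = 6 * X' + 11 * y' by rewrite /X' /y'; ring.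
have yE : 47 * y = 6 * y' - X' by rewrite /X' /y'; ring.
have both q : prime q -> (q %| X')%Z -> (q %| y')%Z -> False.
  move=> q_pr qX' qy'; have [q47|q47] := eqVneq q 47%N.
    case/negP: m47; subst q; case/dvdzP: qX' => X1 X'E; case/dvdzP: qy' => y1 y'E.
    suff : (47%N %| form11 X y)%Z by [].
    apply/dvdzP; exists (form11 X1 y1); apply: (@mulfI _ 47) => //.
    by rewrite -fE X'E y'E /form11; ring.
  have q47' : ~~ (q %| 47)%Z by rewrite dvdzE dvdn_prime2.
  have : (q %| (47 * X)%R)%Z by rewrite XE rpredD // dvdz_mull.
  have : (q %| (47 * y)%R)%Z by rewrite yE rpredB // dvdz_mull.
  rewrite !Euclid_dvdzM // (negPf q47') /= => qy qX.
  exact: (coprimez_no_common_prime q_pr cXy qX qy).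
have norm_y q : prime q -> (q %| form11 X' y')%Z -> (q %| y')%Z -> False.
  move=> q_pr qf qy'; apply: (both q) => //; move: qf; rewrite /form11 -(Euclid_dvdz_sqr X') //.
  have qy2 : (q %| (11 * y' ^+ 2)%R)%Z by rewrite dvdz_mull // Euclid_dvdz_sqr.
  by rewrite rpredDr.
have cXy' : coprimez X' y'.
  rewrite coprimezE; apply: coprime_no_common_prime; last first.
    by move=> q q_pr qX; apply/negP => qy; apply: (both q).
  rewrite !absz_gt0 -negb_and; apply/negP => /andP[/eqP x0 /eqP y0].
  by apply: (both 2%N); rewrite // ?x0 ?y0 dvdz0.
have y'3 : ~~ (3 %| y')%Z.
  apply/negP => y'3; apply: (coprimez_no_common_prime (isT : prime 3) cXy _ y3).
  have y6 : (3 %| (6 * y)%R)%Z by rewrite dvdz_mull.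
  by move: y'3; rewrite /y' rpredDr.
have mo' : odd `|form11 X' y'| by rewrite fEn oddM mo.
have [R [RM R3 Rs]] := norm_form_character_coprime3 cXy' y'3 mo'.
have R47 : (3 %| R 47%N)%N.
  have [k k47] := ex_closed_pchar (isT : prime 47).
  have [w pw] := closed_pchar_prim3 k47 isT.
  rewrite (prim_order_dvd pw) -(Rs _ k) // ?fEn ?dvdn_mulr //.
  have y0 : y'%:~R != 0 :> k.
    rewrite (pchar_intr_eq0 k47); apply/negP; apply: norm_y => //.
    by rewrite fE dvdz_mulr.
  have -> : X' = 6 * y' - 47 * y by rewrite /X' /y'; ring.
  rewrite !(rmorphB, rmorphM) /= (pcharf0 k47 : 47%:~R = 0) mul0r subr0 mulfK //.
  by rewrite cardano_symbol47.
exists R; split.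
- by move=> m n mn; apply: RM; rewrite fEn dvdn_mull.
- have := RM 47%N `|form11 X y|%N; rewrite -fEn dvdnn => /(_ isT).
  move: R3 R47; rewrite /dvdn; lia.
move=> q k w qk qm pw; have q_pr := pcharf_prime qk.
have q3 : q != 3%N by apply: contraNneq m3 => <-.
have qm' : (q %| `|form11 X' y'|)%N by rewrite fEn dvdn_mull.
rewrite -Rs //; congr (cardano_symbol _ _ _).
have y0 : y%:~R != 0 :> k.
  rewrite (pchar_intr_eq0 qk); apply/negP => qy; apply: (coprimez_no_common_prime q_pr cXy _ qy).
  have qy2 : (q %| (11 * y ^+ 2)%R)%Z by rewrite dvdz_mull // Euclid_dvdz_sqr.
  have : (q %| form11 X y)%Z := qm.
  by rewrite /form11 rpredDr // Euclid_dvdz_sqr.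
have y'0 : y'%:~R != 0 :> k.
  by rewrite (pchar_intr_eq0 qk); apply/negP; apply: norm_y.
apply: (mulIf y'0); rewrite divfK //; apply: (mulIf y0); rewrite mulrAC divfK //.
apply/eqP; rewrite -!intrM -subr_eq0 -intrB (pchar_intr_eq0 qk).
rewrite (_ : _ - _ = form11 X y) //; rewrite /form11 /X' /y'; ring.
Qed.

(** * Cardano's formula and the splitting of the cubic modulo p *)

Lemma root_of_triple (R : comNzRingType) (t1 t2 t3 : R) :
  t1 + t2 + t3 = 1 -> t1 * t2 + t1 * t3 + t2 * t3 = -1 -> t1 * t2 * t3 = 1 ->
  t1 ^+ 3 = t1 ^+ 2 + t1 + 1.
Proof.
move=> e1 e2 e3.
transitivity (t1 ^+ 2 * (t1 + t2 + t3) - t1 * (t1 * t2 + t1 * t3 + t2 * t3) + t1 * t2 * t3).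
  by ring.
by rewrite e1 e2 e3; ring.
Qed.

Lemma disc_of_triple (R : comNzRingType) (t1 t2 t3 : R) :
  t1 + t2 + t3 = 1 -> t1 * t2 + t1 * t3 + t2 * t3 = -1 -> t1 * t2 * t3 = 1 ->
  ((t1 - t2) * (t1 - t3) * (t2 - t3)) ^+ 2 = - 44%:R.
Proof.
move=> e1 e2 e3.
transitivity ((t1 + t2 + t3) ^+ 2 * (t1 * t2 + t1 * t3 + t2 * t3) ^+ 2
     - 4%:R * (t1 * t2 + t1 * t3 + t2 * t3) ^+ 3 - 4%:R * (t1 + t2 + t3) ^+ 3 * (t1 * t2 * t3)
     + 18%:R * (t1 + t2 + t3) * (t1 * t2 + t1 * t3 + t2 * t3) * (t1 * t2 * t3)
     - 27%:R * (t1 * t2 * t3) ^+ 2); first by ring.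
by rewrite e1 e2 e3; ring.
Qed.

(** Vieta's formulas: the three integers are the roots of X^3 - X^2 - X - 1 modulo
    [p], with multiplicities. *)
Definition splits_mod (p : nat) : Prop := exists r1 r2 r3 : int,
  [/\ (p %| (r1 + r2 + r3 - 1)%R)%Z,
      (p %| (r1 * r2 + r1 * r3 + r2 * r3 + 1)%R)%Z &
      (p %| (r1 * r2 * r3 - 1)%R)%Z].

Lemma splits_mod_pchar (k : fieldType) (p : nat) (r1 r2 r3 : int) :
  p \in [pchar k] ->
  [/\ (p %| (r1 + r2 + r3 - 1)%R)%Z,
      (p %| (r1 * r2 + r1 * r3 + r2 * r3 + 1)%R)%Z &
      (p %| (r1 * r2 * r3 - 1)%R)%Z] <->
  [/\ r1%:~R + r2%:~R + r3%:~R = 1 :> k,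
      r1%:~R * r2%:~R + r1%:~R * r3%:~R + r2%:~R * r3%:~R = -1 :> k &
      r1%:~R * r2%:~R * r3%:~R = 1 :> k].
Proof.
move=> pk; rewrite -!(pchar_intr_eq0 pk) !(rmorphD, rmorphN, rmorphM, rmorph1) /=.
split=> -[h1 h2 h3]; split; try apply/eqP.
- by rewrite -subr_eq0.
- by rewrite -addr_eq0.
- by rewrite -subr_eq0.
- by rewrite h1 subrr.
- by rewrite h2 addNr.
- by rewrite h3 subrr.
Qed.

(** The images of the integers are already p roots of X^p - X. *)
Lemma frob_fixed_nat (k : fieldType) (p : nat) (x : k) : p \in [pchar k] ->
  x ^+ p = x -> exists n : nat, x = n%:R.
Proof.
move=> pk xp; have p_pr := pcharf_prime pk; have p1 := prime_gt1 p_pr.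
pose rs := [seq i%:R : k | i <- iota 0 p].
have [/mapP[n _ ->]|xrs] := boolP (x \in rs); first by exists n.
have size_P : size ('X^p - 'X : {poly k}) = p.+1.
  by rewrite size_polyDl ?size_polyXn // size_polyN size_polyX.
have P0 : 'X^p - 'X != 0 :> {poly k} by rewrite -size_poly_eq0 size_P.
have := @max_poly_roots _ _ (x :: rs) P0; rewrite size_P /= size_map size_iota ltnn.
case/(_ _ _)/notF.
  rewrite /root !hornerE xp subrr eqxx /=; apply/allP => _ /mapP[n _ ->].
  by rewrite /root !hornerE (frob_int pk n) subrr.
rewrite xrs map_inj_in_uniq ?iota_uniq // => i j; rewrite !mem_iota !add0n /= => ip jp.
move=> /eqP ij; have : (p %| i%:Z - j%:Z)%Z.
  by rewrite -(pchar_intr_eq0 pk) rmorphB subr_eq0.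
move: ip jp; rewrite dvdzE /= => ip jp /dvdnP[[|e] dE]; [|rewrite mulSn in dE]; lia.
Qed.

Section Cardano.
Variables (k : closedFieldType) (p : nat) (w t : k).
Hypotheses (pk : p \in [pchar k]) (p2 : p != 2%N) (p3 : p != 3%N).
Hypotheses (pw : 3.-primitive_root w) (t2 : t ^+ 2 = - 11%:R) (tp : t ^+ p = t).

Let p_pr := pcharf_prime pk.
Let r := 1 + 2%:R * w.

Lemma frob_prim3 : w ^+ p = if (p %% 3 == 1)%N then w else w ^+ 2.
Proof.
rewrite -(expr_mod p (prim_expr_order pw)).
have : (p %% 3 != 0)%N by rewrite -/(3 %| p)%N dvdn_prime2 // eq_sym.
by have := ltn_pmod p (isT : 0 < 3)%N; case: (p %% 3)%N => [|[|[]]].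
Qed.

(** The action of the Frobenius on the two cube roots in Cardano's formula when
    the three roots lie in the prime field: they are exchanged exactly when w and
    w^2 are. *)
Definition frob_compatible (A B : k) :=
  if (p %% 3 == 1)%N then A ^+ p = A /\ B ^+ p = B else A ^+ p = B /\ B ^+ p = A.

Lemma cubic_symbol_cubes (A B : k) : A != 0 -> B != 0 -> frob_compatible A B ->
  cubic_symbol p (A ^+ 3) (B ^+ 3) = 1.
Proof.
move=> A0 B0; rewrite /frob_compatible /cubic_symbol.
have q0 : (p %% 3 != 0)%N by rewrite -/(3 %| p)%N dvdn_prime2 // eq_sym.
have fix1 (x : k) : x != 0 -> x ^+ p = x -> x ^+ p.-1 = 1.
  by move=> x0 xp; apply: (mulfI x0); rewrite -exprS prednK ?prime_gt0 // xp mulr1.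
case: ifPn => pm [Ap Bp]; rewrite -expr_div_n -exprM.
  by rewrite -mul3_divn3_pred // expr_div_n !fix1 // divr1.
by rewrite -mul3_divn3_succ // expr_div_n !exprS Ap Bp [B * A]mulrC divff ?mulf_neq0.
Qed.

Let sqrt33 : (r * t) ^+ 2 = 33%:R.
Proof. by rewrite exprMn t2 prim3_sqrtN3 //; ring. Qed.

(** [A] and [B] are the Lagrange resolvents of the three roots; their cubes are
    the two numbers in the symbol, in one order or the other. *)
Lemma splits_mod_cardano : splits_mod p -> cardano_symbol p w t = 1.
Proof.
case=> r1 [r2 [r3 /(splits_mod_pchar _ _ _ pk)]].
have i1 := frob_int pk r1; have i2 := frob_int pk r2; have i3 := frob_int pk r3.
move: (r1%:~R) (r2%:~R) (r3%:~R) i1 i2 i3 => x y z xp yp zp [e1 e2 e3].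
have w0 := prim3_root pw.
have w3 := prim_expr_order pw.
pose A := x + w * y + w ^+ 2 * z; pose B := x + w ^+ 2 * y + w * z.
have AB : A * B = 4%:R.
  transitivity ((x + y + z) ^+ 2 - 3%:R * (x * y + x * z + y * z)
     + (w ^+ 2 + w + 1) * ((w ^+ 2 - w + 1) * y * z + (x * y + x * z)
                           + (w - 1) * (y ^+ 2 + z ^+ 2))).
    by rewrite /A /B; ring.
  by rewrite e1 e2 w0; ring.
have A_B : A + B = 3%:R * x - 1.
  transitivity (3%:R * x - (x + y + z) + (w ^+ 2 + w + 1) * (y + z)); first by rewrite /A /B; ring.
  by rewrite e1 w0; ring.
have x0 := root_of_triple e1 e2 e3.
have A3B3 : A ^+ 3 + B ^+ 3 = 38%:R.
  transitivity ((A + B) ^+ 3 - 3%:R * (A * B) * (A + B)); first by ring.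
  rewrite AB A_B; transitivity (27%:R * x ^+ 3 - 27%:R * (x ^+ 2 + x) + 11%:R); first by ring.
  by rewrite x0; ring.
have n2 : 2%:R != 0 :> k by rewrite (pchar_natr_eq0 pk) dvdn_prime2.
have AB0 : A * B != 0.
  by rewrite AB (_ : 4%:R = 2%:R * 2%:R); [rewrite mulf_neq0 | ring].
have /andP[A0 B0] : (A != 0) && (B != 0) by rewrite -negb_or -mulf_eq0.
have fAB : frob_compatible A B /\ frob_compatible B A.
  have fA : A ^+ p = x + w ^+ p * y + (w ^+ p) ^+ 2 * z.
    rewrite -{1}(pFrobenius_autE pk) !(rmorphD, rmorphM, rmorphXn) /=.
    by rewrite !pFrobenius_autE xp yp zp.
  have fB : B ^+ p = x + (w ^+ p) ^+ 2 * y + w ^+ p * z.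
    rewrite -{1}(pFrobenius_autE pk) !(rmorphD, rmorphM, rmorphXn) /=.
    by rewrite !pFrobenius_autE xp yp zp.
  have w4 : w ^+ 2 ^+ 2 = w by rewrite -exprM (exprS w 3) w3 mulr1.
  rewrite /frob_compatible fA fB frob_prim3.
  by case: (_ == _)%N; rewrite ?w4.
have : (A ^+ 3 - 19%:R - 3%:R * r * t) * (A ^+ 3 - 19%:R + 3%:R * r * t) = 0.
  transitivity (A ^+ 3 * (A ^+ 3 + B ^+ 3) - (A * B) ^+ 3 - 38%:R * A ^+ 3 + 361%:R
                - 9%:R * (r * t) ^+ 2).
    by ring.
  by rewrite A3B3 AB sqrt33; ring.
move/eqP; rewrite /cardano_symbol mulf_eq0 -/r => /orP[]/eqP A3.
  have -> : 19%:R + 3%:R * r * t = A ^+ 3.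
    by apply/eqP; rewrite eq_sym -subr_eq0 -A3; apply/eqP; ring.
  have -> : 19%:R - 3%:R * r * t = B ^+ 3.
    have -> : B ^+ 3 = 38%:R - A ^+ 3 by rewrite -A3B3; ring.
    by apply/eqP; rewrite -subr_eq0 -A3; apply/eqP; ring.
  exact: cubic_symbol_cubes fAB.1.
have -> : 19%:R - 3%:R * r * t = A ^+ 3.
  by apply/eqP; rewrite eq_sym -subr_eq0 -A3; apply/eqP; ring.
have -> : 19%:R + 3%:R * r * t = B ^+ 3.
  have -> : B ^+ 3 = 38%:R - A ^+ 3 by rewrite -A3B3; ring.
  apply/eqP; rewrite -subr_eq0 -A3; apply/eqP; ring.
exact: cubic_symbol_cubes fAB.2.
Qed.

(** Let A be a cube root of 19 + 3 sqrt(33) and B = 4 / A.  A trivial symbol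
    means that the Frobenius acts on A and B as it does on w and w^2, and so fixes
    the roots (1 + w^i A + w^(-i) B) / 3. *)
Lemma cardano_splits_mod : cardano_symbol p w t = 1 -> splits_mod p.
Proof.
rewrite /cardano_symbol -/r => sym1.
have w0 := prim3_root pw; have w3 := prim_expr_order pw.
have n2 : 2%:R != 0 :> k by rewrite (pchar_natr_eq0 pk) dvdn_prime2.
have n3 : 3%:R != 0 :> k by rewrite (pchar_natr_eq0 pk) dvdn_prime2.
have n4 : 4%:R != 0 :> k by rewrite (_ : 4%:R = 2%:R * 2%:R); [rewrite mulf_neq0 | ring].
have [A A3] : exists A : k, A ^+ 3 = 19%:R + 3%:R * r * t.
  have [|A] := @closed_rootP k ('X^3 - (19%:R + 3%:R * r * t)%:P) _.
    by rewrite size_XnsubC.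
  by rewrite /root !hornerE subr_eq0 => /eqP A3; exists A.
have dd : (19%:R + 3%:R * r * t) * (19%:R - 3%:R * r * t) = 64%:R.
  transitivity (361%:R - 9%:R * (r * t) ^+ 2); first by ring.
  by rewrite sqrt33; ring.
have A0 : A != 0.
  apply: contra_eq_neq dd => A0; rewrite -A3 A0 expr0n mul0r eq_sym.
  by rewrite (_ : 64%:R = 4%:R ^+ 3); [rewrite expf_neq0 | ring].
pose B := 4%:R / A; have AB : A * B = 4%:R by rewrite /B mulrC divfK.
have B0 : B != 0 by rewrite mulf_neq0 ?invr_eq0.
have B3 : B ^+ 3 = 19%:R - 3%:R * r * t.
  apply: (mulfI (expf_neq0 3 A0)); rewrite -exprMn AB A3 dd; ring.
have q0 : (p %% 3 != 0)%N by rewrite -/(3 %| p)%N dvdn_prime2 // eq_sym.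
have rp : r ^+ p = if (p %% 3 == 1)%N then r else - r.
  rewrite /r (frobD pk) expr1n exprMn (frob_int pk 2) frob_prim3.
  by case: (_ == _)%N; rewrite ?prim3_sqrtN3_conj.
have fAB : frob_compatible A B.
  move: sym1; rewrite -A3 -B3 /cubic_symbol /frob_compatible.
  case: ifPn => pm; rewrite -expr_div_n -exprM.
    rewrite -mul3_divn3_pred // => ABp.
    have A3p : (A ^+ 3) ^+ p = A ^+ 3.
      rewrite A3 (frobD pk) !exprMn tp rp pm (frob_int pk 19) (frob_int pk 3) //.
    have A2p : (A ^+ 2) ^+ p = A ^+ 2.
      have -> : A ^+ 2 = 4%:R * (A / B) by rewrite -AB; field; rewrite ?A0 ?B0.
      rewrite exprMn (frob_int pk 4); congr (_ * _).
      by rewrite -(prednK (prime_gt0 p_pr)) exprSr ABp mul1r.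
    have Ap : A ^+ p = A.
      apply: (mulfI (expf_neq0 2 A0)); rewrite -{1}A2p -exprMn -exprSr A3p; ring.
    by split=> //; rewrite /B expr_div_n Ap (frob_int pk 4).
  rewrite -mul3_divn3_succ // !exprS expr_div_n => ABp.
  have ABp4 : A ^+ p * B ^+ p = A * B by rewrite -exprMn AB (frob_int pk 4).
  have A3p : (A ^+ 3) ^+ p = B ^+ 3.
    by rewrite A3 B3 (frobD pk) !exprMn tp rp (negPf pm) (frob_int pk 19) (frob_int pk 3) //; ring.
  have Ap0 : A ^+ p != 0 by rewrite expf_neq0.
  have sq : (A ^+ p) ^+ 2 = B ^+ 2.
    have : B * B ^+ p = A * A ^+ p.
      apply: (mulIf (invr_neq0 (mulf_neq0 A0 Ap0))); rewrite mulfV ?mulf_neq0 // -ABp.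
      by field; rewrite ?A0 ?Ap0.
    move=> BA; apply: (mulfI A0); apply: (mulIf (expf_neq0 p B0)).
    transitivity (A ^+ p * (A ^+ p * B ^+ p) * A); first by ring.
    rewrite ABp4; transitivity (A * B * (A * A ^+ p)); first by ring.
    by rewrite -BA; ring.
  have Ap : A ^+ p = B.
    move/eqP: sq; rewrite eqf_sqr => /orP[/eqP//|/eqP ApN].
    have /eqP := A3p; rewrite -exprM mulnC exprM ApN => BB.
    case/negP: (mulf_neq0 n2 (expf_neq0 3 B0)); move: BB; rewrite -subr_eq0 => /eqP BB.
    by rewrite -oppr_eq0 -BB; apply/eqP; ring.
  by split=> //; apply: (mulfI Ap0); rewrite ABp4 Ap mulrC.
clearbody B; pose x i := (1 + w ^+ i * A + w ^+ (3 - i) * B) / 3%:R.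
have fx i : (i < 3)%N -> exists n : nat, x i = n%:R.
  move=> i3; apply: (frob_fixed_nat pk).
  rewrite /x expr_div_n (frob_int pk 3) (frobD pk) (frobD pk) expr1n.
  rewrite [(_ * A) ^+ p]exprMn [(_ * B) ^+ p]exprMn; congr (_ / _).
  rewrite -!exprM ![(_ * p)%N]mulnC !exprM frob_prim3.
  move: fAB; rewrite /frob_compatible; case: (_ == _)%N => -[-> ->] //.
  rewrite addrAC -!exprM; congr (_ + _ * _ + _ * _); apply/eqP;
  rewrite (eq_prim_root_expr pw); by move: i3; case: i => [|[|[]]].
have [n0 x0] := fx 0%N isT; have [n1 x1] := fx 1%N isT; have [n2' x2] := fx 2%N isT.
exists n0, n1, n2'; apply/(splits_mod_pchar _ _ _ pk); rewrite -[_%:~R]x0 -[_%:~R]x1 -[_%:~R]x2.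
have A3B3 : (A + B) ^+ 3 - 12%:R * (A + B) = 38%:R.
  transitivity (A ^+ 3 + B ^+ 3 + 3%:R * (A * B - 4%:R) * (A + B)); first by ring.
  by rewrite AB subrr A3 B3; ring.
have X0 : x 0%N = (1 + (A + B)) / 3%:R by rewrite /x subn0 w3 expr0; field.
have X12 : x 1%N + x 2%N = (2%:R - (A + B)) / 3%:R.
  transitivity ((2%:R - (A + B) + (w ^+ 2 + w + 1) * (A + B)) / 3%:R); last first.
    by rewrite w0 mul0r addr0.
  by rewrite /x !subSS !subn0 expr1; field.
have X1X2 : x 1%N * x 2%N = (1 - (A + B) + (A + B) ^+ 2 - 12%:R) / 9%:R.
  have n9 : 9%:R != 0 :> k by rewrite (_ : 9%:R = 3%:R * 3%:R); [rewrite mulf_neq0 | ring].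
  transitivity ((1 - (A + B) + (w ^+ 2 + w + 1) * (A + B) + w ^+ 3 * (A ^+ 2 + B ^+ 2)
     + (w ^+ 2 + w ^+ 3 * w) * (A * B)) / 9%:R).
    by rewrite /x !subSS !subn0 expr1; field; rewrite ?n3 ?n9.
  rewrite w3 w0 !mul1r (_ : w ^+ 2 + w = -1); last by apply/eqP; rewrite -addr_eq0 w0.
  congr (_ / _); transitivity (1 - (A + B) + (A + B) ^+ 2 - 3%:R * (A * B)); first by ring.
  by rewrite AB; ring.
move: (x 0%N) (x 1%N) (x 2%N) X0 X12 X1X2 => y0 y1 y2 X0 X12 X1X2.
have n9 : 9%:R != 0 :> k by rewrite (_ : 9%:R = 3%:R * 3%:R); [rewrite mulf_neq0 | ring].
have n27 : 27%:R != 0 :> k by rewrite (_ : 27%:R = 9%:R * 3%:R); [rewrite mulf_neq0 | ring].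
split.
- by rewrite -addrA X12 X0; field.
- by rewrite -mulrDr X12 X1X2 X0; field; rewrite ?n3 ?n9.
rewrite -mulrA X1X2 X0; transitivity ((1 + ((A + B) ^+ 3 - 12%:R * (A + B)) - 12%:R) / 27%:R).
  by field; rewrite ?n3 ?n9 ?n27.
by rewrite A3B3 -[RHS](divff n27); congr (_ / _); ring.
Qed.
End Cardano.

(** * Primes of the form x^2 + 11 y^2 *)

Lemma form11_squarefree_coprime (n : nat) (X y : int) :
  form11 X y = n%:Z -> (forall q, prime q -> ~~ (q ^ 2 %| n)%N) -> coprimez X y.
Proof.
move=> XE sqf; have dvd q : prime q -> (q %| X)%Z -> (q %| y)%Z -> False.
  move=> q_pr /dvdzP[X' X'E] /dvdzP[y' y'E]; case/negP: (sqf q q_pr).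
  suff : ((q ^ 2)%N%:Z %| n%:Z)%Z by [].
  apply/dvdzP; exists (form11 X' y'); rewrite -XE X'E y'E /form11.
  by rewrite -mulnn PoszM; ring.
rewrite coprimezE; apply: coprime_no_common_prime; last first.
  by move=> q q_pr qX; apply/negP => qy; apply: (dvd q).
rewrite !absz_gt0 -negb_and; apply/negP => /andP[/eqP x0 /eqP y0].
by apply: (dvd 2%N); rewrite // ?x0 ?y0 dvdz0.
Qed.

Lemma form11_neq23 (X y n : int) : form11 X y = n -> 1 < n < 4 -> False.
Proof.
rewrite /form11 => XE n4; have y0 : y = 0 by nia.
have X2 : - 2 < X < 2 by nia.
have : X = -1 \/ X = 0 \/ X = 1 by lia.
by case=> [|[]] X0; move: XE; rewrite y0 X0; lia.
Qed.

Lemma form11_splits_mod (p : nat) (X y : int) :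
  prime p -> p != 11%N -> form11 X y = p%:Z -> splits_mod p.
Proof.
move=> p_pr p11 XE.
have [p47|p47] := eqVneq p 47%N.
  (* 47, the norm of the auxiliary element 6 + sqrt(-11), is treated apart. *)
  by rewrite p47; exists 5, 17, 26.
have [p2 p3] : p != 2%N /\ p != 3%N.
  by split; apply/eqP => pE; apply: (form11_neq23 XE); lia.
have cXy : coprimez X y.
  apply: (form11_squarefree_coprime XE) => q q_pr; apply/negP => qp.
  have : (q %| p)%N by apply: dvdn_trans qp; rewrite dvdn_exp.
  rewrite dvdn_prime2 // => /eqP qE; move: qp; rewrite qE => /dvdn_leq -/(_ (prime_gt0 p_pr)).
  by have := prime_gt1 p_pr; nia.
have pE : `|form11 X y|%N = p by rewrite XE.
have po : odd p by have [p2'|] := even_prime p_pr; first by rewrite p2' in p2.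
have [||||R [_ Rp Rs]] := @norm_form_character X y; rewrite ?pE ?dvdn_prime2 1?eq_sym //.
have [k pk] := ex_closed_pchar p_pr; have [w pw] := closed_pchar_prim3 pk p3.
rewrite pE in Rp Rs.
have y0 : y%:~R != 0 :> k.
  rewrite (pchar_intr_eq0 pk); apply/negP => py; apply: (coprimez_no_common_prime p_pr cXy _ py).
  have py2 : (p %| (11 * y ^+ 2)%R)%Z by rewrite dvdz_mull // Euclid_dvdz_sqr.
  by rewrite -(Euclid_dvdz_sqr X) // -(rpredDr _ py2) -/(form11 X y) XE.
apply: (@cardano_splits_mod k p w (X%:~R / y%:~R)) => //.
- have : (form11 X y)%:~R = 0 :> k by rewrite XE; exact: pcharf0 pk.
  rewrite /form11 !(rmorphD, rmorphM, rmorphXn) /= expr_div_n => /eqP.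
  rewrite addr_eq0 => /eqP ->; rewrite mulNr mulfK ?expf_neq0 //.
- by rewrite expr_div_n !(frob_int pk).
by rewrite Rs //; apply/eqP; rewrite -(prim_order_dvd pw).
Qed.

(** Gauss reduction: the form a x^2 + (2b + 1) x y + c y^2 of discriminant -11
    arises from x^2 + x y + 3 y^2 by an integral substitution.  A translation
    makes |2b + 1| at most a; then c < a unless a = 1, and exchanging a and c
    decreases a. *)
Lemma form_disc11_reduction (a b c : int) : 0 < a -> a * c = b ^+ 2 + b + 3 ->
  exists u v s t : int, [/\ a = u ^+ 2 + u * v + 3 * v ^+ 2,
    c = s ^+ 2 + s * t + 3 * t ^+ 2 &
    2 * b + 1 = 2 * u * s + u * t + v * s + 6 * v * t].
Proof.
have [n] := ubnP `|a|%N; elim: n => // n IH in a b c *.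
rewrite ltnS => len a0 ac; have [a1|a1] := eqVneq a 1.
  exists 1, 0, b, 1; split; [by rewrite a1; ring | | by ring].
  by move: ac; rewrite a1 mul1r => ->; ring.
have [b' [j [bE b'a]]] : exists b' j : int, b = b' + j * a /\ `|2 * b' + 1| <= a.
  have a0' : a != 0 by lia.
  have := divz_eq b a; have := modz_ge0 b a0'; have := ltz_pmod b a0.
  move: (divz b a) (modz b a) => d m ltma m0 bE.
  have [le|lt] := lerP (2 * m + 1) a.
    by exists m, d; split; lia.
  by exists (m - a), (d + 1); split; [rewrite bE; ring | lia].
pose c' := c - j * (2 * b' + 1) - j ^+ 2 * a.
have ac' : a * c' = b' ^+ 2 + b' + 3.
  transitivity (a * c - a * j * (2 * b' + 1) - j ^+ 2 * a ^+ 2); first by rewrite /c'; ring.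
  by rewrite ac bE; ring.
have c'0 : 0 < c' by nia.
have c'a : c' < a.
  have sq : (2 * b' + 1) ^+ 2 <= a ^+ 2.
    by rewrite -[_ ^+ 2]real_normK ?num_real // ler_pXn2r // nnegrE // ltW.
  have e4 : 4 * (a * c') = (2 * b' + 1) ^+ 2 + 11 by rewrite ac'; ring.
  have a2 : 2 * 2 <= a ^+ 2 by rewrite expr2 ler_pM //; lia.
  rewrite ltNge; apply/negP => ca.
  have : a ^+ 2 <= a * c' by rewrite expr2 ler_wpM2l // ltW.
  move: (a ^+ 2) (a * c') (_ ^+ 2) sq e4 a2 => *; lia.
have [||u [v [s [t [cE aE bE']]]]] := IH c' (- b' - 1) a _ c'0.
- lia.
- by rewrite mulrC ac'; ring.
exists s, t, (j * s - u), (j * t - v); split=> //.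
  have -> : c = c' + j * (2 * b' + 1) + j ^+ 2 * a by rewrite /c'; ring.
  have -> : 2 * b' + 1 = - (2 * (- b' - 1) + 1) by ring.
  by rewrite bE' cE aE; ring.
have -> : 2 * b + 1 = 2 * j * a - (2 * (- b' - 1) + 1) by rewrite bE; ring.
by rewrite bE' aE; ring.
Qed.

Lemma splits_mod_root (p : nat) : splits_mod p ->
  exists r : int, (p %| (r ^+ 3 - r ^+ 2 - r - 1)%R)%Z.
Proof.
case=> r1 [r2 [r3 [e1 e2 e3]]]; exists r1.
rewrite (_ : _ - 1 = r1 ^+ 2 * (r1 + r2 + r3 - 1)
  - r1 * (r1 * r2 + r1 * r3 + r2 * r3 + 1) + (r1 * r2 * r3 - 1)); last by ring.
by apply: rpredD => //; apply: rpredB; apply: dvdz_mull.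
Qed.

Lemma not_splits_mod3 : ~ splits_mod 3.
Proof.
case/splits_mod_root=> r; have := divz_eq r 3.
have := modz_ge0 r (isT : (3 : int) != 0); have := ltz_pmod r (isT : 0 < 3 :> int).
move: (divz r 3) (modz r 3) => d m m3 m0 ->.
have : m = 0 \/ m = 1 \/ m = 2 by lia.
case=> [|[]] -> /dvdzP[e]; lia.
Qed.

Lemma not_splits_mod5 : ~ splits_mod 5.
Proof.
case/splits_mod_root=> r; have := divz_eq r 5.
have := modz_ge0 r (isT : (5 : int) != 0); have := ltz_pmod r (isT : 0 < 5 :> int).
move: (divz r 5) (modz r 5) => d m m3 m0 ->.
have : m = 0 \/ m = 1 \/ m = 2 \/ m = 3 \/ m = 4 by lia.
case=> [|[|[|[]]]] -> /dvdzP[e]; lia.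
Qed.

Lemma int_parity (v : int) : exists d : int, v = 2 * d \/ v = 2 * d + 1.
Proof.
exists (divz v 2); have := divz_eq v 2; have := modz_ge0 v (isT : (2 : int) != 0).
by have := ltz_pmod v (isT : 0 < 2 :> int); lia.
Qed.

(** The product D of the differences of the roots satisfies D^2 = -44.  Changing D
    modulo p makes it of the form 4 b + 2, and
    (4 b + 2)^2 + 44 = 16 (b^2 + b + 3). *)
Lemma splits_mod_disc (p : nat) : prime p -> p != 2%N -> splits_mod p ->
  exists b : int, (p %| (b ^+ 2 + b + 3)%R)%Z.
Proof.
move=> p_pr p2 [r1 [r2 [r3 sp]]]; have [k pk] := ex_closed_pchar p_pr.
have /(splits_mod_pchar _ _ _ pk)[e1 e2 e3] := sp.
pose D : int := (r1 - r2) * (r1 - r3) * (r2 - r3).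
have DE : (p %| (D ^+ 2 + 44)%R)%Z.
  rewrite -(pchar_intr_eq0 pk) /D !(rmorphD, rmorphN, rmorphM, rmorphXn) /=.
  move: (r1%:~R) (r2%:~R) (r3%:~R) e1 e2 e3 => x y z e1 e2 e3.
  by rewrite (disc_of_triple e1 e2 e3) addNr.
have [E [EE Eo]] : exists E : int, (p %| (E ^+ 2 + 44)%R)%Z /\ exists b, E = 4 * b + 2.
  have [m pm] : exists m : int, p%:Z = 2 * m + 1.
    exists (p./2)%:Z; have [|po] := even_prime p_pr; first by move/eqP; rewrite (negPf p2).
    by have := odd_double_half p; rewrite po; lia.
  have key (j : int) : (p %| ((D + j * p%:Z) ^+ 2 + 44)%R)%Z.
    rewrite (_ : _ + 44 = (D ^+ 2 + 44) + p%:Z * (2 * D * j + j ^+ 2 * p%:Z)); last by ring.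
    by rewrite rpredD // dvdz_mulr.
  have [d [c [DE' c4]]] : exists d c : int, D = 4 * d + c /\ (0 <= c < 4).
    exists (divz D 4), (modz D 4); have := ltz_pmod D (isT : 0 < 4 :> int).
    by have := divz_eq D 4; have := modz_ge0 D (isT : (4 : int) != 0); lia.
  have [j [h jE]] : exists j h : int, D + j * p%:Z = 4 * h + 2.
    have [n [s [mE s2]]] : exists n s : int, m = 2 * n + s /\ (s = 0 \/ s = 1).
      by have [n [mE|mE]] := int_parity m; [exists n, 0 | exists n, 1]; lia.
    have c4' : c = 0 \/ c = 1 \/ c = 2 \/ c = 3 by lia.
    case: s2 => sE.
      by exists (2 - c), (d + (2 - c) * n + 0); rewrite pm DE' mE sE; ring.
    by exists (c - 2), (d + (c - 2) * n + c - 2); rewrite pm DE' mE sE; ring.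
  by exists (D + j * p%:Z); split; [exact: key | exists h].
case: Eo => b Eb; exists b.
have : (p %| (2%N%:Z ^+ 4 * (b ^+ 2 + b + 3))%R)%Z.
  by rewrite (_ : _ * _ = E ^+ 2 + 44) // Eb; ring.
rewrite Euclid_dvdzM // dvdzE abszX Euclid_dvdX //= dvdn_prime2 // (negPf p2) //.
Qed.

(** Reduction gives p = u^2 + u v + 3 v^2, which is a value of x^2 + 11 y^2 if v is
    even.  If v is odd, multiplying u + v (1 + sqrt(-11)) / 2 by an element of
    norm 5 makes 5 p such a value.  Then the symbols at 5 and at p have trivial
    product, although the one at p is trivial and the one at 5 is not. *)
Lemma splits_mod_form11 (p : nat) : prime p -> p != 2%N -> p != 11%N ->
  splits_mod p -> exists X y : int, form11 X y = p%:Z.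
Proof.
move=> p_pr p2 p11 sp.
have [p47|p47] := eqVneq p 47%N; first by exists 6, 1; rewrite p47.
have p3 : p != 3%N by apply/eqP => pE; rewrite pE in sp; exact: not_splits_mod3.
have p5 : p != 5%N by apply/eqP => pE; rewrite pE in sp; exact: not_splits_mod5.
have [b /dvdzP[c bc]] := splits_mod_disc p_pr p2 sp.
have p0 : 0 < p%:Z by rewrite ltz_nat prime_gt0.
rewrite mulrC in bc.
have [u [v [_ [_ [pE _ _]]]]] := form_disc11_reduction p0 (esym bc).
have [v' [vE|vE]] := int_parity v.
  by exists (u + v'), v'; rewrite pE vE /form11; ring.
have [X [y XE]] : exists X y, form11 X y = (5 * p)%N%:Z.
  have [s [sE|sE]] : exists s, u = 2 * s \/ u = 2 * s - v.
    have [d [uE|uE]] := int_parity u; first by exists d; left.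
    by exists (d + v' + 1); right; rewrite uE vE; ring.
  - by exists (3 * s - 2 * v), (s + v); rewrite PoszM pE sE /form11; ring.
  - by exists (3 * s + 2 * v), (v - s); rewrite PoszM pE sE /form11; ring.
have cXy : coprimez X y.
  apply: (form11_squarefree_coprime XE) => q q_pr; apply/negP => qp.
  have q_2 : (q %| 5 * p)%N by apply: dvdn_trans qp; rewrite dvdn_exp.
  have c5 : coprime 5 p by rewrite prime_coprime // dvdn_prime2 // eq_sym.
  move: q_2; rewrite Euclid_dvdM // !dvdn_prime2 // => /orP[]/eqP qE; move: qp; rewrite qE.
    by rewrite -mulnn dvdn_pmul2l // dvdn_prime2 // eq_sym (negPf p5).
  by rewrite -mulnn dvdn_pmul2r ?prime_gt0 // dvdn_prime2 // (negPf p5).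
have fE : `|form11 X y|%N = (5 * p)%N by rewrite XE.
have po : odd p by have [p2'|] := even_prime p_pr; first by rewrite p2' in p2.
have [|||R [RM R3 Rs]] := @norm_form_character X y cXy; rewrite ?fE ?oddM ?po //.
- by rewrite Euclid_dvdM // !dvdn_prime2 //= eq_sym.
- by rewrite Euclid_dvdM // !dvdn_prime2 //= eq_sym.
rewrite fE in RM R3 Rs.
have sqrtN11 q (k : fieldType) : q \in [pchar k] -> (q %| 5 * p)%N ->
  (X%:~R / y%:~R) ^+ 2 = - 11%:R :> k.
  move=> qk qp; have q_pr := pcharf_prime qk.
  have y0 : y%:~R != 0 :> k.
    rewrite (pchar_intr_eq0 qk); apply/negP => qy; apply: (coprimez_no_common_prime q_pr cXy _ qy).
    have qy2 : (q %| (11 * y ^+ 2)%R)%Z by rewrite dvdz_mull // Euclid_dvdz_sqr.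
    by rewrite -(Euclid_dvdz_sqr X) // -(rpredDr _ qy2) -/(form11 X y) XE.
  have : (form11 X y)%:~R = 0 :> k by apply/eqP; rewrite XE (pchar_intr_eq0 qk).
  rewrite /form11 !(rmorphD, rmorphM, rmorphXn) /= expr_div_n => /eqP.
  by rewrite addr_eq0 => /eqP ->; rewrite mulNr mulfK ?expf_neq0.
have Rp : (3 %| R p)%N.
  have [k pk] := ex_closed_pchar p_pr; have [w pw] := closed_pchar_prim3 pk p3.
  rewrite (prim_order_dvd pw) -(Rs p k) ?dvdn_mull //; apply/eqP.
  apply: splits_mod_cardano => //; exact: (sqrtN11 p k pk (dvdn_mull _ (dvdnn _))).
have [k k5] := ex_closed_pchar (isT : prime 5).
have [w pw] := closed_pchar_prim3 k5 isT.
have /negP := cardano_symbol5 k5 pw (sqrtN11 5%N k k5 (dvdn_mulr _ (dvdnn _))).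
case; rewrite (Rs 5%N k) ?dvdn_mulr // -(prim_order_dvd pw).
have := RM 5%N p (dvdnn _); move: R3 Rp; rewrite /dvdn; lia.
Qed.

(** * Prime ideals *)

Section Comap.
Variables (R S : comNzRingType) (f : {rmorphism R -> S}) (P : prime_idealr S).

Definition comap : {pred R} := fun x => f x \in P.

Lemma mem_comap x : (x \in comap) = (f x \in P).
Proof. by []. Qed.

Fact comap_idealr_closed : idealr_closed comap.
Proof.
split; rewrite ?mem_comap ?rmorph0 ?rpred0 ?rmorph1 ?idealr1 // => r x y.
by rewrite !mem_comap => fx fy; rewrite rmorphD rmorphM rpredD // idealMr.
Qed.

Fact comap_prime : prime_idealr_closed comap.
Proof. by move=> x y; rewrite !mem_comap rmorphM prime_idealrM. Qed.

HB.instance Definition _ := isIdealr.Build R comap comap_idealr_closed.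
HB.instance Definition _ := isPrimeIdealrClosed.Build R comap comap_prime.
End Comap.

Section PrimeIdeals.
Variable R : comNzRingType.
Implicit Type P : prime_idealr R.

Lemma prime_ideal_prod P (I : finType) (A : pred I) (F : I -> R) :
  \prod_(i | A i) F i \in P -> exists2 i, A i & F i \in P.
Proof.
move=> FP; apply/exists_inP; apply: contraLR FP; rewrite negb_exists_in => /forall_inP nF.
apply: (big_ind (fun x => x \notin P)) => //.
  by rewrite idealr1.
by move=> x y xP yP; rewrite prime_idealrM negb_or xP.
Qed.

Lemma mem_prime_prod P (I : finType) (A : pred I) (F : I -> R) i :
  A i -> F i \in P -> \prod_(i | A i) F i \in P.
Proof. by move=> Ai FP; rewrite (bigD1 i) //= mulrC idealMr. Qed.

Lemma int_in_prime P (p : nat) (m : int) : prime p -> p%:R \in P ->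
  (m%:~R \in P) = (p %| m)%Z.
Proof.
move=> p_pr pP; apply/idP/idP => [mP|/dvdzP[q ->]]; last by rewrite rmorphM idealMr.
apply/negPn/negP => pm; have : coprimez p m.
  by rewrite coprimezE prime_coprime // -dvdzE.
case/coprimezP=> -[u v] /= uv; have : (1 : R) \in P; last by rewrite idealr1.
by rewrite -[1](rmorph1 intr) -uv rmorphD !rmorphM rpredD // idealMr.
Qed.

(** An ideal maximal among those that contain [a] and not 1 is prime.  The empty
    set satisfies [good], so that the union of an empty chain does as well. *)
Lemma ex_prime_ideal (a : R) : (forall b, a * b != 1) ->
  exists P : prime_idealr R, a \in P.
Proof.
move=> na.
pose good (A : set R) := [/\ forall r x y, A x -> A y -> A (r * x + y),
  forall x, A x -> A a & ~ A 1].
have [A [[Aid Aa A1] Amax]] : exists A, good A /\ forall B, (A `<` B)%classic -> ~ good B.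
  apply: Zorn_bigcup => F Fgood Ftot; split.
  - move=> r x y [X FX Xx] [Y FY Yy].
    have [XY|YX] := Ftot X Y FX FY.
      by exists Y => //; have [Yid _ _] := Fgood Y FY; apply: Yid => //; apply: XY.
    by exists X => //; have [Xid _ _] := Fgood X FX; apply: Xid => //; apply: YX.
  - by move=> x [X FX Xx]; exists X => //; have [_ Xa _] := Fgood X FX; apply: Xa Xx.
  - by move=> [X FX X1]; have [_ _ ] := Fgood X FX.
have aA : A a.
  apply: contrapT => naA; have A0 x : ~ A x by move=> /Aa.
  apply: (Amax [set x | exists b, x = a * b]%classic).
    by split=> [x /A0//|/(_ a) h]; apply: naA; apply: h; exists 1; rewrite mulr1.
  split.
  - by move=> r _ _ [b ->] [b' ->]; exists (r * b + b'); rewrite mulrDr mulrCA.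
  - by move=> _ _; exists 1; rewrite mulr1.
  - by case=> b /esym/eqP ab; have := na b; rewrite ab.
have A0 : A 0 by have := Aid (-1) _ _ aA aA; rewrite mulN1r addNr.
have AM r x : A x -> A (r * x) by move=> Ax; have := Aid r _ _ Ax A0; rewrite addr0.
pose I : {pred R} := fun x => `[< A x >].
have inI x : (x \in I) <-> A x by split=> [/asboolP|Ax] //; apply/asboolP.
have Iid : idealr_closed I.
  split; [exact/inI | by apply/negP => /inI | move=> r x y /inI Ax /inI Ay; exact/inI/Aid].
have grow u : ~ A u -> exists r x, A x /\ 1 = r * u + x.
  move=> nu; apply: contrapT => no.
  apply: (Amax [set z | exists r x, A x /\ z = r * u + x]%classic).
    split=> [x Ax|/(_ u) h]; first by exists 0, x; rewrite mul0r add0r.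
    by apply: nu; apply: h; exists 1, 0; rewrite mul1r addr0.
  split=> //.
  - move=> r _ _ [r1 [x1 [Ax1 ->]]] [r2 [x2 [Ax2 ->]]].
    exists (r * r1 + r2), (r * x1 + x2); split; first exact: Aid.
    by rewrite mulrDr mulrDl mulrA addrACA.
  - by move=> _ _; exists 0, a; rewrite mul0r add0r.
have Ipr : prime_idealr_closed I.
  move=> u v /inI Auv; apply/orP; apply: contrapT => /not_orP[/inI nu /inI nv].
  have [r [x [Ax rx]]] := grow _ nu; have [s [y [Ay sy]]] := grow _ nv.
  apply: A1; rewrite -[1]mulr1 {1}rx sy.
  rewrite (_ : _ * _ = (r * s) * (u * v) + ((r * u + x) * y + (s * v) * x)); last by ring.
  by apply: (Aid) => //; have := Aid 1 _ _ (AM (r * u + x) _ Ay) (AM (s * v) _ Ax); rewrite mul1r.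
pose P : prime_idealr R := HB.pack I (isIdealr.Build R I Iid) (isPrimeIdealrClosed.Build R I Ipr).
by exists P; apply/inI.
Qed.

(** In a monic relation modulo P for an element x of Q, the constant term is an
    integer of Q, hence of P; so x times a shorter monic expression lies in P. *)
Lemma prime_incomparable P (Q : prime_idealr R) (p : nat) (x : R) (q : {poly int}) :
  prime p -> p%:R \in P -> {subset P <= Q} -> q \is monic ->
  (map_poly intr q).[x] \in P -> x \in Q -> x \in P.
Proof.
move=> p_pr pP PQ + + xQ; elim/poly_ind: q => [|q c IH].
  by rewrite monicE lead_coef0.
move=> mon; rewrite rmorphD rmorphM /= map_polyX map_polyC /= hornerD hornerM hornerX hornerC.
move=> qcP; have cQ : c%:~R \in Q.
  have qxQ : (map_poly intr q).[x] * x \in Q by rewrite idealMr.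
  by rewrite -(rpredDl _ qxQ) PQ.
have cP : c%:~R \in P by move: cQ; rewrite !(@int_in_prime _ p) // PQ.
have [q0|q0] := eqVneq q 0.
  move: mon; rewrite q0 mul0r add0r monicE lead_coefC => /eqP c1.
  by move: cP; rewrite c1 idealr1.
have : (map_poly intr q).[x] * x \in P by rewrite -(rpredDr _ cP).
rewrite prime_idealrM => /orP[|//]; apply: IH.
move: mon; rewrite !monicE lead_coefDl ?lead_coefMX //.
by rewrite size_mulX // size_polyC; case: (c != 0); rewrite // ltnS size_poly_gt0.
Qed.
End PrimeIdeals.

(** * Finite group actions whose invariants are the integers *)

Section GaloisRing.
Variables (O : comNzRingType) (gT : finGroupType) (act : gT -> {rmorphism O -> O}).
Hypothesis act1 : forall x, act 1%g x = x.
Hypothesis actM : forall s t x, act (s * t)%g x = act t (act s x).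
Hypothesis act_fixed : forall x, (forall s, act s x = x) -> exists m : int, x = m%:~R.
Hypothesis O_integral : forall x : O, exists2 q : {poly int},
  q \is monic & (map_poly intr q).[x] = 0.
Variable p : nat.
Hypothesis p_pr : prime p.
Implicit Type P Q : prime_idealr O.

Lemma ring_trace x : exists m : int, \sum_s act s x = m%:~R.
Proof.
apply: act_fixed => t; rewrite rmorph_sum [RHS](reindex_inj (mulIg t)) /=.
by apply: eq_bigr => s _; rewrite actM.
Qed.

Lemma ring_norm x : exists m : int, \prod_s act s x = m%:~R.
Proof.
apply: act_fixed => t; rewrite rmorph_prod [RHS](reindex_inj (mulIg t)) /=.
by apply: eq_bigr => s _; rewrite actM.
Qed.

(** Such an element exists when the conjugates of [P] are pairwise distinct.  It
    serves to recover an element modulo [P] from its trace. *)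
Definition isolating P (c : O) :=
  c \notin P /\ forall s : gT, s != 1%g -> act s c \in P.

Lemma isolating_trace P c x : isolating P c ->
  exists2 m : int, \sum_s act s (c * x) = m%:~R & m%:~R - c * x \in P.
Proof.
case=> cP sc; have [m mE] := ring_trace (c * x); exists m => //.
rewrite -mE (bigD1 1%g) //= act1 [X in X - _]addrC addrK.
by apply: rpred_sum => s s1; rewrite rmorphM mulrC idealMr // sc.
Qed.

(** The traces of c x and of c are integers congruent to c x and c modulo P, and c
    is invertible modulo P. *)
Lemma isolating_residue P c x : isolating P c -> p%:R \in P ->
  exists m : int, x - m%:~R \in P.
Proof.
move=> isoc pP; have [m _ mP] := isolating_trace x isoc.
have [d _ dP] := isolating_trace 1 isoc; rewrite mulr1 in dP.
have [cP _] := isoc.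
have pd : ~~ (p %| d)%Z.
  apply/negP; rewrite -(int_in_prime _ p_pr pP) => dP'.
  by case/negP: cP; rewrite -(subKr d%:~R c) rpredB.
have : coprimez p d by rewrite coprimezE prime_coprime // -dvdzE.
case/coprimezP=> -[u v] /= uv; exists (v * m).
have -> : x - (v * m)%:~R =
    (u%:~R * x) * p%:R + (v%:~R * x) * (d%:~R - c) - v%:~R * (m%:~R - c * x).
  have -> : x - (v * m)%:~R = (u * p%:Z + v * d)%:~R * x - (v * m)%:~R by rewrite uv mul1r.
  by rewrite !(rmorphD, rmorphM) /=; ring.
by rewrite rpredB ?rpredD // idealMr.
Qed.

Lemma act_injective P c s t : isolating P c ->
  comap (act s) P =i comap (act t) P -> s = t.
Proof.
move=> [cP sc] /(_ (act s^-1%g c)); rewrite !mem_comap -!actM mulVg act1 (negPf cP).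
move/esym/negP => nt; apply/eqP/negPn/negP => ts.
by apply: nt; apply: sc; rewrite -eq_mulVg1.
Qed.

Section Decomposition.
Variables (n : nat) (P : 'I_n -> prime_idealr O).
Hypotheses (nE : n = #|gT|) (P_inj : forall i j, P i =i P j -> i = j).
Hypothesis P_prod : principal_ideal (p%:R : O) = ideal_prod (fun i => P i).

Lemma factor_contains_p i : p%:R \in P i.
Proof.
have : principal_ideal (p%:R : O) p%:R by exists 1; rewrite ?mulr1.
rewrite P_prod => -[m [r [a [aP ->]]]]; apply: rpred_sum => k _.
by rewrite idealMr // (@mem_prime_prod _ _ _ _ _ i).
Qed.

Lemma factor_incomparable i Q : p%:R \in Q -> {subset P i <= Q} -> P i =i Q.
Proof.
move=> pQ PQ x; apply/idP/idP; first exact: PQ.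
have [q qm q0] := O_integral x; apply: (prime_incomparable p_pr (factor_contains_p i) PQ qm).
by rewrite q0 rpred0.
Qed.

(** Otherwise every factor has an element outside Q, and the product of these
    elements lies in the ideal of p but not in Q. *)
Lemma prime_over_p_is_factor Q : p%:R \in Q -> exists i, P i =i Q.
Proof.
move=> pQ; apply: contrapT => no.
have ex_a i : exists a, a \in P i /\ a \notin Q.
  apply: contrapT => nex; apply: no; exists i; apply: factor_incomparable => // x xP.
  by apply/negPn/negP => xQ; apply: nex; exists x.
have [a aP] := choice ex_a.
have : ideal_prod (fun i => P i) (\prod_i a i).
  exists 1%N, (fun=> 1), (fun _ => a); split; first by move=> _ i; exact: (aP i).1.
  by rewrite big_ord1 mul1r.
rewrite -P_prod => -[b _ pb]; have : \prod_i a i \in Q by rewrite -pb mulrC idealMr.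
by case/prime_ideal_prod => i _; apply/negP; exact: (aP i).2.
Qed.

(** The factors form one orbit: an element lying in exactly the factors outside the
    orbit of one of them would have a norm that lies in p Z and in none of the
    primes of the orbit.  There are as many factors as group elements, so the
    conjugates of a factor are distinct. *)
Lemma ex_isolating : exists (Q : prime_idealr O) (c : O), p%:R \in Q /\ isolating Q c.
Proof.
have ex_c i : exists c, c \notin P i /\ forall j, j != i -> c \in P j.
  have ex_a j : exists a, a \notin P i /\ (j != i -> a \in P j).
    have [->|ji] := eqVneq j i; first by exists 1; rewrite idealr1.
    apply: contrapT => nex; case/eqP: ji; apply: P_inj.
    apply: factor_incomparable (factor_contains_p i) _ => x xj.
    by apply/negPn/negP => xi; apply: nex; exists x.
  have [a aP] := choice ex_a; exists (\prod_(j | j != i) a j); split.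
    by apply/negP => /prime_ideal_prod[j _]; apply/negP; exact: (aP j).1.
  by move=> j ji; apply: (@mem_prime_prod _ _ _ _ _ j) => //; exact: (aP j).2.
have [c cP] := choice ex_c.
have n0 : (0 < n)%N by rewrite nE; apply/card_gt0P; exists 1%g.
pose i0 := Ordinal n0.
have ex_pi s : exists j, P j =i comap (act s) (P i0).
  by apply: prime_over_p_is_factor; rewrite mem_comap rmorph_nat factor_contains_p.
have [pi piP] := choice ex_pi.
have pi_surj j : j \in codom pi.
  apply/negPn/negP => jpi; pose y := \sum_(i in codom pi) c i.
  have yj : y \in P j.
    apply: rpred_sum => i ipi; apply: (cP i).2; apply: contraNneq jpi => -> //.
  have [m mE] := ring_norm y.
  have : m%:~R \in P j by rewrite -mE (bigD1 1%g) //= act1 mulrC idealMr.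
  rewrite (int_in_prime _ p_pr (factor_contains_p j)).
  rewrite -(int_in_prime _ p_pr (factor_contains_p i0)) -mE.
  case/prime_ideal_prod => s _; rewrite -mem_comap -piP.
  rewrite /y (bigD1 (pi s)) ?codom_f //= => ys; case/negP: (cP (pi s)).1.
  (* Modulo [P (pi s)] the sum y is its term of index [pi s], which is not 0. *)
have rest : \sum_(i in codom pi | i != pi s) c i \in P (pi s).
    by apply: rpred_sum => i /andP[_ ips]; apply: (cP i).2; rewrite eq_sym.
  by rewrite -(rpredDr _ rest).
have pi_inj : injective pi.
  apply/injectiveP/card_uniqP; rewrite size_codom -nE -[RHS]card_ord.
  exact/eq_card/pi_surj.
exists (P i0), (c i0); split; first exact: factor_contains_p.
split; first exact: (cP i0).1.
move=> s s1; rewrite -mem_comap -piP; apply: (cP i0).2.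
have -> : i0 = pi 1%g by apply: P_inj => x; rewrite piP mem_comap act1.
by rewrite (inj_eq pi_inj).
Qed.
End Decomposition.

Section Splitting.
Variables (P : prime_idealr O) (c : O).
Hypotheses (isoc : isolating P c) (pP : p%:R \in P).

Lemma act_isolating s t : (act s (act t^-1%g c) \in P) = (s != t).
Proof.
rewrite -actM; have [->|st] := eqVneq s t.
  by rewrite mulVg act1 (negPf isoc.1).
by rewrite isoc.2 // -eq_mulVg1 eq_sym.
Qed.

Lemma dvd_of_int_multiple (x : O) (m : int) : ~~ (p %| m)%Z ->
  (exists u, m%:~R * x = p%:R * u) -> exists u, x = p%:R * u.
Proof.
move=> pm [u mu]; have : coprimez p m by rewrite coprimezE prime_coprime // -dvdzE.
case/coprimezP=> -[a b] /= ab; exists (a%:~R * x + b%:~R * u).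
transitivity ((a * p%:Z + b * m)%:~R * x); first by rewrite ab mul1r.
by rewrite rmorphD !rmorphM /= mulrDl -[b%:~R * m%:~R * x]mulrA mu; ring.
Qed.

(** The matrix of the s (t^-1 c) is invertible and diagonal modulo P.  Its product
    with the row of the conjugates of x consists of traces, which are integers in
    P and hence multiples of p; the adjugate matrix then gives the result. *)
Lemma isolating_matrix x : (forall s, act s x \in P) ->
  exists2 d, d \notin P & forall s, exists u, d * act s x = p%:R * u.
Proof.
move=> xP; pose e (i : 'I_#|gT|) : gT := enum_val i.
pose M : 'M[O]_#|gT| := \matrix_(i, j) act (e i) (act (e j)^-1%g c).
exists (\det M).
  rewrite /determinant (bigD1 1%g) //= rpredDr.
    rewrite odd_perm1 expr0 mul1r; apply/negP => /prime_ideal_prod[i _].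
    by rewrite perm1 mxE act_isolating eqxx.
  apply: rpred_sum => s s1; apply: idealMr.
  have [i si] : exists i, s i != i.
    apply/existsP; apply: contraNT s1; rewrite negb_exists => /forallP fs.
    by apply/eqP/permP => i; rewrite perm1; apply/eqP; rewrite -[_ == _]negbK fs.
  apply: (@mem_prime_prod _ _ _ _ _ i) => //.
  by rewrite mxE act_isolating (inj_eq enum_val_inj) eq_sym.
pose X : 'rV[O]_#|gT| := \row_i act (e i) x.
have [T XM] : exists T : 'rV[O]_#|gT|, X *m M = p%:R *: T.
  have ex_T j : exists t : O, (X *m M) 0 j = p%:R * t.
    have [m mE] := ring_trace (x * act (e j)^-1%g c).
    have XMj : (X *m M) 0 j = m%:~R.
      rewrite mxE -mE [RHS](reindex_inj (mulgI 1%g)) /=.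
      rewrite [RHS](reindex (fun i => e i)) /=.
        by apply: eq_bigr => i _; rewrite !mxE mul1g rmorphM.
      by exists enum_rank => s _; rewrite /e ?enum_valK ?enum_rankK.
    have : m%:~R \in P.
      by rewrite -mE; apply: rpred_sum => s _; rewrite rmorphM mulrC idealMr.
    by rewrite (int_in_prime _ p_pr pP) XMj => /dvdzP[q ->]; exists q%:~R; rewrite rmorphM mulrC.
  have [T TP] := choice ex_T; exists (\row_j T j).
  by apply/rowP => j; rewrite TP !mxE.
move=> s; have : X *m M *m \adj M = \det M *: X.
  by rewrite -mulmxA mul_mx_adj mul_mx_scalar.
rewrite XM => /rowP/(_ (enum_rank s)); rewrite -scalemxAl !mxE /e enum_rankK.
by move=> <-; exists (\sum_j T 0 j * \adj M j (enum_rank s)).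
Qed.

(** The e with e x in p O form an ideal that contains all conjugates of the
    determinant d, hence the trace of c d, an integer prime to p. *)
Lemma conjugates_intersection x :
  (forall s, act s x \in P) -> exists u, x = p%:R * u.
Proof.
move=> xP; have [d dP dx] := isolating_matrix xP.
have dQ s : exists u, act s d * x = p%:R * u.
  have [u du] := dx s^-1%g; exists (act s u).
  by rewrite -[x in LHS](act1 x) -(mulVg s) actM -rmorphM du rmorphM rmorph_nat.
have [m mE mP] := isolating_trace d isoc.
apply: (@dvd_of_int_multiple _ m).
  rewrite -(int_in_prime _ p_pr pP); apply/negP => mP'.
  have : c * d \in P by rewrite -(subKr m%:~R (c * d)) rpredB.
  by rewrite prime_idealrM (negPf isoc.1) (negPf dP).
have [u uP] := choice dQ; exists (\sum_s act s c * u s).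
rewrite -mE mulr_suml mulr_sumr; apply: eq_bigr => s _.
by rewrite rmorphM -mulrA uP mulrCA.
Qed.

(** With e_s = s^-1 c, which lies in every conjugate of P but the one of index s,
    both p e_s^(n-1) and p^n belong to the product of the conjugates.  The sum of
    the e_s^n is a trace and an integer prime to p, so p itself belongs to it. *)
Lemma isolating_splits n : n = #|gT| -> exists Ps : 'I_n -> prime_idealr O,
  (forall i j, Ps i =i Ps j -> i = j) /\
  principal_ideal (p%:R : O) = ideal_prod (fun i => Ps i).
Proof.
move=> nE; pose e (i : 'I_n) : gT := enum_val (cast_ord nE i).
have e_inj : injective e by move=> i j /enum_val_inj/cast_ord_inj.
have e_surj s : exists i, e i = s.
  by exists (cast_ord (esym nE) (enum_rank s)); rewrite /e cast_ordKV enum_rankK.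
have n0 : (0 < n)%N by rewrite nE; apply/card_gt0P; exists 1%g.
exists (fun i => comap (act (e i)) P : prime_idealr O); split.
  by move=> i j /(act_injective isoc)/e_inj.
rewrite predeqE => x; split.
  case=> b _ <-; have [m mE mc] := isolating_trace (c ^+ n.-1) isoc.
  have pm : ~~ (p %| m)%Z.
    rewrite -(int_in_prime _ p_pr pP); apply/negP => mP.
    have : c * c ^+ n.-1 \in P by rewrite -(subKr m%:~R (c * _)) rpredB.
    rewrite -exprS (prednK n0) -[n]card_ord -prodr_const => /prime_ideal_prod[i _].
    by rewrite (negPf isoc.1).
  have : coprimez (p%:Z ^+ n.-1) m.
    by rewrite coprimezXl // coprimezE prime_coprime // -dvdzE.
  case/coprimezP=> -[a1 a2] /= a12; pose e' i := act (e i)^-1%g c.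
  have mE' : \sum_i e' i ^+ n = m%:~R.
    rewrite -mE -exprS prednK // (reindex_inj invg_inj) (reindex e) /=.
      by apply: eq_bigr => i _; rewrite rmorphXn.
    by exists (fun s => cast_ord (esym nE) (enum_rank s)) => s _;
      rewrite /e ?cast_ordKV ?enum_rankK // enum_valK cast_ordK.
  exists n.+1, (fun k => if unlift ord0 k is Some i then b * a2%:~R * e' i else b * a1%:~R),
    (fun k j => if unlift ord0 k is Some i then (if j == i then p%:R else e' i) else p%:R).
  split=> [k j|].
    case: unliftP => [i _|_]; last by rewrite mem_comap rmorph_nat.
    have [->|ji] := eqVneq j i; first by rewrite mem_comap rmorph_nat.
    by rewrite mem_comap act_isolating (inj_eq e_inj).
  rewrite big_ord_recl unlift_none prodr_const card_ord.
  rewrite (eq_bigr (fun i => b * a2%:~R * p%:R * e' i ^+ n)) => [|i _]; last first.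
    rewrite liftK (bigD1 i) //= eqxx (eq_bigr (fun=> e' i)) => [|j /negPf->//].
    rewrite prodr_const cardC1 card_ord -[in RHS](prednK n0) exprS; ring.
  rewrite -mulr_sumr mE'.
  transitivity ((a1 * p%:Z ^+ n.-1 + a2 * m)%:~R * (p%:R * b) : O).
    by rewrite a12 mul1r.
  by rewrite rmorphD !rmorphM rmorphXn /= -[in p%:R ^+ n](prednK n0) exprS; ring.
case=> m [r [a [aP ->]]].
have [|u ->] := @conjugates_intersection (\sum_k r k * \prod_i a k i); last by exists u.
move=> s; have [i <-] := e_surj s; rewrite -mem_comap; apply: rpred_sum => k _.
by apply: idealMr; apply: (@mem_prime_prod _ _ _ _ _ i).
Qed.
End Splitting.
End GaloisRing.

(** * The ring of integers of the splitting field *)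

Lemma integral_rat (L : fieldExtType rat) (x : rat) :
  integralOver (intr : int -> L) (in_alg L x) -> exists m : int, x = m%:~R.
Proof.
case=> q qm; have -> : map_poly (intr : int -> L) q = map_poly (in_alg L) (map_poly intr q).
  by rewrite -map_poly_comp; apply: eq_map_poly => m; exact/esym/(rmorph_int (in_alg L)).
rewrite fmorph_root => q0.
have ratrZ : map_poly (ratr : rat -> algC) (map_poly intr q) = map_poly intr q.
  rewrite -map_poly_comp; apply: eq_map_poly => m.
  exact: (rmorph_int (ratr : {rmorphism rat -> algC})).
have /Cint_rat_Aint : (ratr x : algC) \in Aint.
  apply: (@root_monic_Aint (map_poly intr q)).
  - by rewrite -ratrZ fmorph_root.
  - by rewrite monic_map.
  - by apply/polyOverP => j; rewrite coef_map /= intr_int.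
move=> /(_ (Crat_rat x))/intrP[m xm]; exists m.
apply: (fmorph_inj (ratr : {rmorphism rat -> algC})); rewrite /= xm.
exact/esym/(rmorph_int (ratr : {rmorphism rat -> algC})).
Qed.

Section Action.
Variable L : splittingFieldType rat.
Hypothesis galL : galois 1 {:L}.
Local Notation O := (ring_of_integers L).
Local Notation G := (gal_of {:L}).

Lemma integral_aut (f : {rmorphism L -> L}) (x : O) :
  f (int_val x) \in is_algebraic_integer (L:=L).
Proof.
have /asboolP[q qm q0] := int_valP x; apply/asboolP; exists q => //.
rewrite (_ : map_poly intr q = map_poly f (map_poly intr q)) ?fmorph_root //.
by rewrite -map_poly_comp; apply: eq_map_poly => m; exact/esym/(rmorph_int f).
Qed.

Definition int_aut (f : {rmorphism L -> L}) (x : O) : O := RingOfIntegers (integral_aut f x).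

Lemma int_val_inj : injective (@int_val L). Proof. exact: val_inj. Qed.
Lemma int_valM x y : int_val (x * y : O) = int_val x * int_val y. Proof. by []. Qed.
Lemma int_val_int (m : int) : int_val (m%:~R : O) = m%:~R.
Proof. exact: (rmorph_int (val : {rmorphism O -> L})). Qed.

Fact int_aut_zmod f : zmod_morphism (int_aut f).
Proof. by move=> x y; apply: int_val_inj; rewrite /= rmorphB. Qed.
Fact int_aut_monoid f : monoid_morphism (int_aut f).
Proof. by split=> [|x y]; apply: int_val_inj; rewrite /= ?rmorph1 ?rmorphM. Qed.
HB.instance Definition _ f := GRing.isZmodMorphism.Build O O (int_aut f) (int_aut_zmod f).
HB.instance Definition _ f := GRing.isMonoidMorphism.Build O O (int_aut f) (int_aut_monoid f).

Definition gal_act (s : G) : {rmorphism O -> O} := int_aut (s : {rmorphism L -> L}).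

Lemma val_gal_act s x : int_val (gal_act s x) = s (int_val x). Proof. by []. Qed.

Lemma gal_act1 x : gal_act 1%g x = x.
Proof. by apply: int_val_inj; rewrite val_gal_act gal_id. Qed.

Lemma gal_actM s t x : gal_act (s * t)%g x = gal_act t (gal_act s x).
Proof. by apply: int_val_inj; rewrite !val_gal_act galM ?memvf. Qed.

Lemma gal_act_fixed x : (forall s, gal_act s x = x) -> exists m : int, x = m%:~R.
Proof.
move=> fx; have : int_val x \in 1%AS.
  rewrite -(galois_fixedField galL); apply/fixedFieldP; first exact: memvf.
  by move=> s _; rewrite -val_gal_act fx.
case/vlineP=> r xr; have [m rm] : exists m : int, r = m%:~R.
  by apply: (@integral_rat L); rewrite /= -xr; exact/asboolP/int_valP.
by exists m; apply: int_val_inj; rewrite xr rm int_val_int -[RHS]mulr1z scaler_int.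
Qed.

Lemma integers_integral (x : O) :
  exists2 q : {poly int}, q \is monic & (map_poly intr q).[x] = 0.
Proof.
have /asboolP[q qm q0] := int_valP x; exists q => //; apply: int_val_inj.
transitivity (map_poly (val : {rmorphism O -> L}) (map_poly intr q)).[int_val x].
  by rewrite horner_map.
rewrite -map_poly_comp; apply/eqP; move: q0; rewrite /root; congr (_.[_] == _).
by apply: eq_map_poly => m; exact/esym/int_val_int.
Qed.

Lemma gal_card : \dim {:L} = #|{: G}|.
Proof.
have := galois_dim galL; rewrite dimv1 divn1 => ->; apply: eq_card => s.
by rewrite gal_kHom ?sub1v ?k1AHom.
Qed.
End Action.

Lemma monic_int_integral (L : fieldExtType rat) (x : L) (q : {poly int}) :
  q \is monic -> (map_poly intr q).[x] = 0 -> x \in @is_algebraic_integer L.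
Proof. by move=> qm q0; apply/asboolP; exists q => //; apply/eqP. Qed.

(** Vieta's formulas, read off from the values of the polynomial at 0, 1 and -1. *)
Lemma cubic_splitting_roots (L : fieldExtType rat) :
  splittingFieldFor 1%VS
    (map_poly (in_alg L) ('X^3 - 'X^2 - 'X - 1 : {poly rat})) {:L}%VS ->
  exists t1 t2 t3 : L, [/\ t1 + t2 + t3 = 1, t1 * t2 + t1 * t3 + t2 * t3 = -1,
    t1 * t2 * t3 = 1 & <<1 & [:: t1; t2; t3]>>%VS = {:L}%VS].
Proof.
rewrite !rmorphB /= !map_polyXn map_polyX rmorph1 => -[rs fE gen].
have sz : size ('X^2 + 'X + 1 : {poly L}) = 3%N.
  rewrite -addrA size_polyDl ?size_polyXn //.
  by rewrite size_polyDl ?size_polyX ?size_poly1.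
have E : 'X^3 - 'X^2 - 'X - 1 = 'X^3 - ('X^2 + 'X + 1) :> {poly L} by rewrite !opprD !addrA.
have fm : 'X^3 - 'X^2 - 'X - 1 \is @monic L.
  by rewrite E monicE lead_coefDl ?lead_coefXn // size_polyN size_polyXn sz.
have szf : size ('X^3 - 'X^2 - 'X - 1 : {poly L}) = 4%N.
  by rewrite E size_polyDl ?size_polyXn // size_polyN sz.
move: fE; rewrite eqp_monic ?monic_prod_XsubC // => /eqP fE.
have szr : size rs = 3%N by move: szf; rewrite fE size_prod_XsubC => -[].
case: rs szr fE gen => [|t1 [|t2 [|t3 [|]]]] // _; rewrite !big_cons big_nil mulr1 => fE gen.
exists t1, t2, t3.
have ev x : x ^+ 3 - x ^+ 2 - x - 1 = (x - t1) * ((x - t2) * (x - t3)).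
  by have := congr1 (fun q : {poly L} => q.[x]) fE; rewrite !hornerE.
have e3 : t1 * t2 * t3 = 1.
  transitivity (- ((0 - t1) * ((0 - t2) * (0 - t3)))); [by ring | rewrite -ev; ring].
have two0 : (2%:R : L) != 0 by rewrite -[2%:R](rmorph_nat (in_alg L)) fmorph_eq0.
have e2 : t1 * t2 + t1 * t3 + t2 * t3 = -1.
  apply: (mulfI two0).
  transitivity ((1 - t1) * ((1 - t2) * (1 - t3)) - (-1 - t1) * ((-1 - t2) * (-1 - t3)) - 2%:R).
    by ring.
  by rewrite -!ev; ring.
split=> //.
apply: (mulfI two0).
transitivity (- ((1 - t1) * ((1 - t2) * (1 - t3)) + (-1 - t1) * ((-1 - t2) * (-1 - t3))
                 + 2%:R * (t1 * t2 * t3))).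
  by ring.
by rewrite -!ev e3; ring.
Qed.

Section SplittingField.
Variable L : splittingFieldType rat.
Variables t1 t2 t3 : L.
Hypotheses (e1 : t1 + t2 + t3 = 1) (e2 : t1 * t2 + t1 * t3 + t2 * t3 = -1)
  (e3 : t1 * t2 * t3 = 1) (gen : <<1 & [:: t1; t2; t3]>>%VS = {:L}%VS).
Local Notation O := (ring_of_integers L).

Lemma ext_natr_eq0 n : (n%:R == 0 :> L) = (n == 0)%N.
Proof. by rewrite -(rmorph_nat (in_alg L)) fmorph_eq0 pnatr_eq0. Qed.

Lemma roots_distinct : uniq [:: t1; t2; t3].
Proof.
have : ((t1 - t2) * (t1 - t3) * (t2 - t3)) ^+ 2 != 0.
  by rewrite disc_of_triple // oppr_eq0 ext_natr_eq0.
rewrite expf_eq0 /= !mulf_eq0 !subr_eq0 !negb_or => /andP[/andP[t12 t13] t23].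
by rewrite t12 t13 t23.
Qed.

Lemma splitting_field_galois : galois 1 {:L}.
Proof.
apply/splitting_galoisField; exists (\prod_(x <- [:: t1; t2; t3]) ('X - x%:P)); split.
- rewrite (_ : \prod_(_ <- _) _ = 'X^3 - 'X^2 - 'X - 1); last first.
    rewrite !big_cons big_nil mulr1.
    transitivity ('X^3 - (t1 + t2 + t3)%:P * 'X^2
      + (t1 * t2 + t1 * t3 + t2 * t3)%:P * 'X - (t1 * t2 * t3)%:P).
      by rewrite !(polyCD, polyCM); ring.
    by rewrite e1 e2 e3 polyCN polyC1; ring.
  by rewrite !rpredB ?rpredX ?polyOverX ?rpred1.
- by rewrite separable_prod_XsubC roots_distinct.
- by exists [:: t1; t2; t3] => //; rewrite eqpxx.
Qed.

Lemma root_integral (x : L) : x ^+ 3 = x ^+ 2 + x + 1 -> x \in @is_algebraic_integer L.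
Proof.
move=> x3; apply: (@monic_int_integral L x ('X^3 - ('X^2 + 'X + 1))).
  rewrite monicE lead_coefDl ?lead_coefXn // size_polyN size_polyXn.
  by rewrite -addrA size_polyDl ?size_polyXn // size_polyDl ?size_polyX ?size_poly1.
by rewrite !(rmorphB, rmorphD) /= !map_polyXn map_polyX rmorph1 !hornerE x3 subrr.
Qed.

Lemma ex_integer_roots : exists T1 T2 T3 : O,
  (int_val T1 = t1 /\ int_val T2 = t2 /\ int_val T3 = t3) /\
  (T1 + T2 + T3 = 1 /\ T1 * T2 + T1 * T3 + T2 * T3 = -1 /\ T1 * T2 * T3 = 1).
Proof.
have x1 := root_of_triple e1 e2 e3.
have x2 : t2 ^+ 3 = t2 ^+ 2 + t2 + 1.
  apply: (@root_of_triple _ t2 t1 t3); [rewrite -e1 | rewrite -e2 | rewrite -e3]; ring.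
have x3 : t3 ^+ 3 = t3 ^+ 2 + t3 + 1.
  apply: (@root_of_triple _ t3 t1 t2); [rewrite -e1 | rewrite -e2 | rewrite -e3]; ring.
exists (RingOfIntegers (root_integral x1)), (RingOfIntegers (root_integral x2)),
  (RingOfIntegers (root_integral x3)); split=> //.
by split; [|split]; apply: int_val_inj; rewrite /= ?e1 ?e2 ?e3.
Qed.

(** The element is (1 + sqrt(-11)) / 2, where 2 sqrt(-11) is the product of the
    differences of the roots. *)
Lemma ex_half_sqrtN11 : exists A : O, A ^+ 2 - A + 3%:R = 0.
Proof.
have two0 : (2%:R : L) != 0 by rewrite ext_natr_eq0.
pose D := (t1 - t2) * (t1 - t3) * (t2 - t3).
have D2 : D ^+ 2 = - 44%:R by exact: disc_of_triple.
pose a := (2%:R + D) / 4%:R.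
have four0 : (4%:R : L) != 0 by rewrite ext_natr_eq0.
have aE : a ^+ 2 - a + 3%:R = 0.
  transitivity ((D ^+ 2 + 44%:R) / 16%:R); last by rewrite D2 addNr mul0r.
  by rewrite /a; field; rewrite ?ext_natr_eq0.
have aI : a \in @is_algebraic_integer L.
  apply: (@monic_int_integral L a ('X^2 - ('X - 3%:P))).
    by rewrite monicE lead_coefDl ?lead_coefXn // size_polyN size_polyXn size_XsubC.
  rewrite !rmorphB /= map_polyXn map_polyX map_polyC !hornerE /= -aE; ring.
by exists (RingOfIntegers aI); apply: int_val_inj; rewrite -[RHS]aE.
Qed.

Lemma gal_move_root (s : gal_of {:L}) : s != 1%g ->
  exists2 t, t \in [:: t1; t2; t3] & s t != t.
Proof.
move=> s1; have [/allP fix_rs|/allPn[t trs st]] := boolP (all (fun t => s t == t) [:: t1; t2; t3]).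
  case/eqP: s1; apply/eqP/gal_eqP => x _; rewrite gal_id.
  have : (<<1 & [:: t1; t2; t3]>> <= fixedField [set s])%VS.
    apply/Fadjoin_seqP; split; first exact: sub1v.
    move=> t trs; apply/fixedFieldP; first exact: memvf.
    by move=> u; rewrite inE => /eqP ->; apply/eqP/fix_rs.
  rewrite gen => /subvP/(_ x (memvf x))/mem_fixedFieldP[_]; apply.
  by rewrite inE.
by exists t.
Qed.

Variable p : nat.
Hypothesis p_pr : prime p.

(** Reduction of the roots modulo a prime with residue field F_p splits the cubic.
    For p = 2, reduction of (1 + sqrt(-11)) / 2 would give a root of X^2 - X + 3
    in F_2. *)
Lemma splits_completely_splits_mod : splits_completely L p -> splits_mod p /\ p != 2%N.
Proof.
case=> P [P_inj P_prod].
have fixedZ := gal_act_fixed splitting_field_galois.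
have [Q [c [pQ isoc]]] := ex_isolating (@gal_act1 L) (@gal_actM L) fixedZ
   (@integers_integral L) p_pr (gal_card splitting_field_galois) P_inj P_prod.
have res x := isolating_residue (@gal_act1 L) (@gal_actM L) fixedZ p_pr x isoc pQ.
have [T1 [T2 [T3 [_ [E1 [E2 E3]]]]]] := ex_integer_roots.
have [m1 h1] := res T1; have [m2 h2] := res T2; have [m3 h3] := res T3.
split.
  exists m1, m2, m3; rewrite -!(int_in_prime _ p_pr pQ) !(rmorphD, rmorphN, rmorphM, rmorph1) /=.
  move: h1 h2 h3; move: (m1%:~R) (m2%:~R) (m3%:~R) => x y z h1 h2 h3; split.
  - have -> : x + y + z - 1 = - ((T1 - x) + (T2 - y) + (T3 - z)) by rewrite -E1; ring.
    by rewrite rpredN; apply: rpredD => //; apply: rpredD.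
  - have -> : x * y + x * z + y * z + 1 =
        - ((y + z) * (T1 - x) + (T1 + z) * (T2 - y) + (T1 + T2) * (T3 - z)).
      by rewrite -[1]opprK -E2; ring.
    by rewrite rpredN; apply: rpredD; [apply: rpredD|]; apply: idealMr.
  - have -> : x * y * z - 1 = - ((y * z) * (T1 - x) + (T1 * z) * (T2 - y) + (T1 * T2) * (T3 - z)).
      by rewrite -E3; ring.
    by rewrite rpredN; apply: rpredD; [apply: rpredD|]; apply: idealMr.
apply/eqP => p2; have [A A0] := ex_half_sqrtN11; have [m hm] := res A.
have : (p %| (m ^+ 2 - m + 3)%R)%Z.
  rewrite -(int_in_prime _ p_pr pQ) !(rmorphD, rmorphN, rmorphXn) /=.
  have -> : m%:~R ^+ 2 - m%:~R + 3%:~R = - ((A + m%:~R - 1) * (A - m%:~R)).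
    by rewrite -[LHS](addr0) -{1}oppr0 -A0; ring.
  by rewrite rpredN idealMr.
rewrite p2; have [h [->|->]] := int_parity m => /dvdzP[e]; lia.
Qed.

Lemma prime_not_unit (b : O) : p%:R * b != 1.
Proof.
apply/eqP => pb; have p0 : (p%:R : rat) != 0 by rewrite pnatr_eq0 -lt0n prime_gt0.
have bE : int_val b = in_alg L p%:R^-1.
  have pL : (p%:R : L) != 0 by rewrite ext_natr_eq0 -lt0n prime_gt0.
  apply: (mulfI pL); rewrite fmorphV rmorph_nat mulfV //.
  transitivity (int_val (p%:R * b : O)); last by rewrite pb.
  by rewrite int_valM; congr (_ * _); exact/esym/(int_val_int _ p).
have [m mE] : exists m : int, p%:R^-1 = m%:~R :> rat.
  by apply: (@integral_rat L); rewrite -bE; exact/asboolP/int_valP.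
have : (p%:Z * m)%:~R = 1 :> rat by rewrite rmorphM /= -mE mulfV.
move/eqP; rewrite -[1]/(1%:~R) eqr_int => /eqP pm.
have : (p %| 1%R)%Z by rewrite -pm dvdz_mulr.
by rewrite dvdz1 => /eqP /= p1; move: p_pr; rewrite p1.
Qed.

(** Two distinct roots satisfy x^2 + x y + y^2 - x - y - 1 = 0.  If they are
    congruent, x is a double root modulo P, so that 3 x + 1 or x - 1 lies in P;
    then 22 or 2 does. *)
Lemma roots_incongruent (P : prime_idealr O) (x y : O) : p != 2%N -> p != 11%N ->
  p%:R \in P -> x ^+ 3 = x ^+ 2 + x + 1 -> y ^+ 3 = y ^+ 2 + y + 1 ->
  x != y -> x - y \notin P.
Proof.
move=> p2 p11 pP x3 y3 xy; apply/negP => xyP.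
have xy0 : x ^+ 2 + x * y + y ^+ 2 - x - y - 1 = 0.
  have : int_val (x - y) != 0 by rewrite -(inj_eq (@int_val_inj L)) in xy; rewrite subr_eq0.
  move=> nz; apply: int_val_inj; apply: (mulfI nz); rewrite mulr0 -int_valM.
  rewrite (_ : _ * _ = 0) //.
  transitivity ((x ^+ 3 - x ^+ 2 - x) - (y ^+ 3 - y ^+ 2 - y)); first by ring.
  by rewrite x3 y3; ring.
have : (3%:R * x + 1) * (x - 1) \in P.
  have -> : (3%:R * x + 1) * (x - 1) = (2%:R * x + y - 1) * (x - y).
    by rewrite -[LHS]subr0 -xy0; ring.
  by rewrite idealMr.
have bad (n : nat) : ~~ (p %| n)%N -> n%:R \in P -> False.
  by move=> pn; have := int_in_prime n p_pr pP; rewrite dvdzE /= (negPf pn) => ->.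
rewrite prime_idealrM => /orP[] h.
  apply: (bad 22%N).
    by rewrite (_ : 22 = 2 * 11)%N // Euclid_dvdM // !dvdn_prime2 // negb_or p2.
  have -> : 22%:R = (9%:R * x ^+ 2 - 12%:R * x - 5%:R) * (3%:R * x + 1)
      - 27%:R * (x ^+ 3 - (x ^+ 2 + x + 1)) :> O by ring.
  by rewrite x3 subrr mulr0 subr0 idealMr.
apply: (bad 2%N); first by rewrite dvdn_prime2.
have -> : 2%:R = (x ^+ 2 - 1) * (x - 1) - (x ^+ 3 - (x ^+ 2 + x + 1)) :> O by ring.
by rewrite x3 subrr subr0 idealMr.
Qed.

(** Each root is congruent to an integer modulo a prime P over p.  If s^-1 moves
    the root T, congruent to r, then s^-1 T is not congruent to T, and s^-1 (T - r)
    is an element outside P that s sends into P.  The product of such elements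
    over all s other than 1 is isolating. *)
Lemma splits_mod_splits_completely : p != 2%N -> p != 11%N ->
  splits_mod p -> splits_completely L p.
Proof.
move=> p2 p11 [r1 [r2 [r3 [d1 d2 d3]]]].
have [P pP] := ex_prime_ideal prime_not_unit.
have rootP (x : O) : x ^+ 3 = x ^+ 2 + x + 1 -> exists r : int, x - r%:~R \in P.
  move=> x3; have : (x - r1%:~R) * (x - r2%:~R) * (x - r3%:~R) \in P.
    have -> : (x - r1%:~R) * (x - r2%:~R) * (x - r3%:~R) =
       (x ^+ 3 - (x ^+ 2 + x + 1)) - x ^+ 2 * (r1 + r2 + r3 - 1)%:~R
       + x * (r1 * r2 + r1 * r3 + r2 * r3 + 1)%:~R - (r1 * r2 * r3 - 1)%:~R.
      by rewrite !(rmorphD, rmorphN, rmorphM, rmorph1) /=; ring.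
    rewrite x3 subrr sub0r rpredB ?rpredD ?rpredN ?idealMr // ?(int_in_prime _ p_pr pP) //.
  by rewrite !prime_idealrM => /orP[/orP[]|] h; [exists r1 | exists r2 | exists r3].
have [T1 [T2 [T3 [[v1 [v2 v3]] [E1 [E2 E3]]]]]] := ex_integer_roots.
have T1r := root_of_triple E1 E2 E3.
have T2r : T2 ^+ 3 = T2 ^+ 2 + T2 + 1.
  apply: (@root_of_triple _ T2 T1 T3); [rewrite -E1 | rewrite -E2 | rewrite -E3]; ring.
have T3r : T3 ^+ 3 = T3 ^+ 2 + T3 + 1.
  apply: (@root_of_triple _ T3 T1 T2); [rewrite -E1 | rewrite -E2 | rewrite -E3]; ring.
have ex_x s : exists x : O, s != 1%g -> x \notin P /\ gal_act s x \in P.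
  have [->|s1] := eqVneq s 1%g; first by exists 0.
  have [t trs st] := @gal_move_root s^-1%g (ltac:(by rewrite -(inj_eq invg_inj) invgK invg1)).
  have [T [vT T3']] : exists T : O, int_val T = t /\ T ^+ 3 = T ^+ 2 + T + 1.
    move: trs; rewrite !inE => /or3P[]/eqP ->; [exists T1 | exists T2 | exists T3]; split=> //.
  have [r Tr] := rootP T T3'.
  exists (gal_act s^-1%g (T - r%:~R)) => _; split; last first.
    by rewrite -gal_actM mulVg gal_act1.
  rewrite rmorphB rmorph_int; apply/negP => Tr'.
  have sT3 : gal_act s^-1%g T ^+ 3 = gal_act s^-1%g T ^+ 2 + gal_act s^-1%g T + 1.
    by rewrite -rmorphXn T3' !rmorphD rmorphXn rmorph1.
  have neq : gal_act s^-1%g T != T.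
    by apply: contraNneq st => /(congr1 (@int_val L)); rewrite val_gal_act vT => ->.
  case/negP: (roots_incongruent p2 p11 pP sT3 T3' neq).
  have -> : gal_act s^-1%g T - T = (gal_act s^-1%g T - r%:~R) - (T - r%:~R) by ring.
  by rewrite rpredB.
have [x xP] := choice ex_x.
have isoc : isolating (@gal_act L) P (\prod_(s | s != 1%g) x s).
  split; first by apply/negP => /prime_ideal_prod[s /xP[/negP]].
  move=> s s1; rewrite rmorph_prod; apply: (@mem_prime_prod _ _ _ _ _ s) => //.
  exact: (xP s s1).2.
exact: (isolating_splits (@gal_act1 L) (@gal_actM L) (gal_act_fixed splitting_field_galois) p_pr
  isoc pP (gal_card splitting_field_galois)).
Qed.
End SplittingField.

Theorem theorem2p1 (L : fieldExtType rat)
    (splitL : splittingFieldFor 1%VS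
       (map_poly (in_alg L) ('X^3 - 'X^2 - 'X - 1 : {poly rat})) {:L}%VS)
    (p : nat) (p_prime : prime p) (p_neq11 : p <> 11%N) :
  splits_completely L p <->
  exists x y : int, p%:Z = x ^+ 2 + 11 * y ^+ 2.
Proof.
have fK : map_poly (in_alg L) ('X^3 - 'X^2 - 'X - 1) \is a polyOver 1%VS.
  by apply/polyOver1P; exists ('X^3 - 'X^2 - 'X - 1).
have axL : SplittingField.axiom L by exists (map_poly (in_alg L) ('X^3 - 'X^2 - 'X - 1)).
case: L splitL fK axL => T cT splitL _ axL.
pose L : splittingFieldType rat :=
  HB.pack T cT (FieldExt_isSplittingField.Build rat (FieldExt.Pack cT) axL).
have [t1 [t2 [t3 [e1 e2 e3 gen]]]] := @cubic_splitting_roots L splitL.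
have p11 : p != 11%N by apply/eqP.
split.
  case/(@splits_completely_splits_mod L t1 t2 t3 e1 e2 e3 gen p p_prime) => sp p2.
  have [X [y XE]] := splits_mod_form11 p_prime p2 p11 sp.
  by exists X, y; rewrite -XE.
case=> X [y XE].
apply: (@splits_mod_splits_completely L t1 t2 t3 e1 e2 e3 gen p p_prime) => //.
  by apply/eqP => p2; apply: (form11_neq23 (esym XE)); rewrite p2.
exact: (form11_splits_mod p_prime p11 (esym XE)).
Qed.
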